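(* Let $K$ be a differential field over $\mathbb{C}$ with derivation $D$, let $G$ be a finite group of $\mathbb{C}$-algebra automorphisms of $K$ commuting with $D$, let $K^G$ be the fixed point subfield, and let $(M,Y_M)$ be a non-zero finite-dimensional indecomposable vertex algebra $(K^G,D)$-module. Then: (1) There exists $g\in G$ such that $M$ has a $g$-twisted vertex algebra $(K,D)$-module structure over $(M,Y_M)$. (2) Let $g\in G$ and let $(M,\tilde Y^1_M)$, $(M,\tilde Y^2_M)$ be two $g$-twisted vertex algebra $(K,D)$-module structures over $(M,Y_M)$ such that $\psi[K,(M,\tilde Y^1_M)]=\psi[K,(M,\tilde Y^2_M)]$. Then $(M,\tilde Y^1_M)\cong (M,\tilde Y^2_M)$ as $g$-twisted vertex algebra $(K,D)$-modules. (3) Let $g\in G$ and let $(M,\tilde Y_M)$ be a $g$-twisted vertex algebra $(K,D)$-module structure over $(M,Y_M)$. Then the maps $\tilde Y_M\circ h$, $h\in G$, are all distinct homomorphisms from $K$ to $(\operatorname{End}_{\mathbb{C}}M)((x^{1/|g|}))$, where $|g|$ is the order of $g$. (4) For $k=1,2$, let $g_k\in G$ be of order $p_k$ and let $(M,\tilde Y^k_M)$ be a $g_k$-twisted vertex algebra $(K,D)$-module structure over $(M,Y_M)$. Then $(M,\tilde Y^1_M)\circ h\cong (M,\tilde Y^2_M)$ for some $h\in G$.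
   Context: A differential field over $\mathbb{C}$ with derivation $D$ is a field $K\supseteq\mathbb{C}$ with a $\mathbb{C}$-linear derivation $D:K\to K$. For each positive integer $p$ a primitive $p$-th root of unity $\zeta_p$ is fixed. Vertex algebra of $(A,D)$. Let $A$ be a commutative associative unital $\mathbb{C}$-algebra with a derivation $D$. It is a vertex algebra with vacuum $1$ and $Y(a,x)b=\sum_{i\ge 0}\frac{1}{i!}(D^ia)b\,x^i=\sum_{j\in\mathbb{Z}}(a_jb)x^{-j-1}$; thus $a_{-1-i}b=\frac1{i!}(D^ia)b$ for $i\ge0$ and $a_jb=0$ for $j\ge 0$. Twisted modules. Let $g$ be a $\mathbb{C}$-algebra automorphism of $A$ commuting with $D$, of finite order $p$, and put $A^r=\{a\in A: ga=\zeta_p^r a\}$, $0\le r\le p-1$. A $g$-twisted vertex algebra $(A,D)$-module is a $\mathbb{C}$-vector space $M$ with a linear map $Y_M(\cdot,x):A\to(\operatorname{End}_{\mathbb{C}}M)[[x^{1/p},x^{-1/p}]]$, $Y_M(a,x)=\sum_{i\in(1/p)\mathbb{Z}}a_ix^{-i-1}$, such that: (i) $Y_M(u,x)=\sum_{i\in r/p+\mathbb{Z}}u_ix^{-i-1}$ for $u\in A^r$; (ii) $Y_M(u,x)w\in M((x^{1/p}))$ for $u\in A$, $w\in M$; (iii) $Y_M(1,x)=\mathrm{id}_M$; (iv) for $u\in A^r$, $v\in A^s$, $m\in r/p+\mathbb{Z}$, $n\in s/p+\mathbb{Z}$, $l\in\mathbb{Z}$, $$\sum_{i\ge0}\binom{m}{i}(u_{l+i}v)_{m+n-i}=\sum_{i\ge0}\binom{l}{i}(-1)^i\big(u_{l+m-i}v_{n+i}+(-1)^{l+1}v_{l+n-i}u_{m+i}\big).$$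 A vertex algebra $(A,D)$-module is the case $g=1$, $p=1$. Isomorphisms are linear isomorphisms intertwining the maps $Y(\cdot,x)$; a module is indecomposable if it is not a direct sum of two non-zero submodules. Structures over $(M,Y_M)$. For a finite-dimensional vertex algebra $(K^G,D)$-module $(M,Y_M)$ and $g\in G$ of order $p$, a $g$-twisted vertex algebra $(K,D)$-module structure over $(M,Y_M)$ is a $g$-twisted vertex algebra $(K,D)$-module $(M,\tilde Y_M)$ on the same vector space $M$, where $\tilde Y_M(\cdot,x)$ is a linear map $K\to(\operatorname{End}_{\mathbb{C}}M)((x^{1/p}))$, such that $\tilde Y_M(\cdot,x)|_{K^G}=Y_M(\cdot,x)$. Composition with $h$. For a $g$-twisted vertex algebra $(K,D)$-module $(M,\tilde Y_M)$ and $h\in G$, $(M,\tilde Y_M)\circ h$ is the same vector space with the map $\tilde Y_M\circ h: a\mapsto\tilde Y_M(ha,x)$; it is an $h^{-1}gh$-twisted vertex algebra $(K,D)$-module. The map $\psi$. For a finite-dimensional $g$-twisted vertex algebra $(A,D)$-module $(M,Y_M)$, with $g$ of order $p$, let $\mathcal{A}_M(A)\subseteq\operatorname{End}_{\mathbb{C}}M$ be the subalgebra generated by all coefficients of all $Y_M(a,x)$, $a\in A$. It is a finite-dimensional commutative $\mathbb{C}$-algebra, so $\mathcal{A}_M(A)=\bigoplus_{i=1}^m\mathbb{C}e_i\oplus\mathcal{J}_M(A)$ with $e_1,\dots,e_m$ primitive orthogonal idempotents and $\mathcal{J}_M(A)$ the Jacobson radical. Let $X\mapsto X^{[0]}$ be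 the projection $\mathcal{A}_M(A)\to\bigoplus_i\mathbb{C}e_i\cong\mathbb{C}^m$, extended coefficientwise to $\mathcal{A}_M(A)((x^{1/p}))\to\mathbb{C}((x^{1/p}))^{\oplus m}$. Then $\psi[A,(M,Y_M)]$ is the $\mathbb{C}$-algebra homomorphism $a\mapsto Y_M(a,x)^{[0]}$ from $A$ to $\mathbb{C}((x^{1/p}))^{\oplus m}$. For any $g$-twisted vertex algebra $(K,D)$-module structure $(M,\tilde Y_M)$ over a non-zero finite-dimensional indecomposable $(K^G,D)$-module one has $m=1$ for $A=K$, so that $\psi[K,(M,\tilde Y_M)]:K\to\mathbb{C}((x^{1/p}))$. *)

(* Defs.v *)
From HB Require Import structures.
From mathcomp Require Import all_boot all_order all_algebra all_fingroup.
From mathcomp Require Import boolp classical_sets functions cardinality fsbigop.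
From mathcomp Require Import reals complex.

Set Implicit Arguments.
Unset Strict Implicit.
Unset Printing Implicit Defensive.

Import GRing.Theory.

Local Open Scope classical_set_scope.
Local Open Scope ring_scope.

(* Algebras over [C] that are fields; no finiteness of the degree, contrary to
   [fieldExtType]. *)
#[short(type="fieldAlgType")]
HB.structure Definition FieldAlgebra (C : nzRingType) :=
  {K of GRing.UnitAlgebra C K & GRing.Field K}.

Record derivation (C : fieldType) (A : comAlgType C) := Derivation {
  der :> A -> A;
  der_linear : linear der;
  derM : forall a b, der (a * b) = der a * b + a * der b
}.

(* A finite group of [C]-algebra automorphisms of [K] commuting with [D] is a
   finite group acting faithfully on [(K, D)]. The product of the group is the
   composition of functions, [aut (g * h) = aut g \o aut h]. *)
Record autGroup (C : fieldType) (K : fieldAlgType C) (D : derivation K)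
    (G : finGroupType) := AutGroup {
  aut :> G -> {lrmorphism K -> K};
  aut1 : forall a, aut 1%g a = a;
  autM : forall g h a, aut (g * h)%g a = aut g (aut h a);
  aut_faithful : forall g, aut g =1 id -> g = 1%g;
  aut_der : forall g a, aut g (D a) = D (aut g a)
}.

Section FixedField.
Context (C : fieldType) (K : fieldAlgType C) (D : derivation K).
Context (G : finGroupType) (act : autGroup D G).

Definition fixed_pred : {pred K} := fun a => [forall g, act g a == a].

Lemma fixed_predP a : reflect (forall g, act g a = a) (a \in fixed_pred).
Proof. exact: 'forall_eqP. Qed.

Fact fixed_divring_closed : divring_closed fixed_pred.
Proof.
split=> [|a b /fixed_predP Ha /fixed_predP Hb|a b /fixed_predP Ha /fixed_predP Hb];
  apply/fixed_predP => g.
- exact: rmorph1.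
- by rewrite rmorphB /= Ha Hb.
- by rewrite rmorphM fmorphV /= Ha Hb.
Qed.

Fact fixed_scaler_closed : scaler_closed fixed_pred.
Proof.
by move=> c a /fixed_predP Ha; apply/fixed_predP => g; rewrite linearZ /= Ha.
Qed.

HB.instance Definition _ := GRing.isDivringClosed.Build K fixed_pred
  fixed_divring_closed.
HB.instance Definition _ := GRing.isScaleClosed.Build C K fixed_pred
  fixed_scaler_closed.

Record fixed := Fixed {fixed_val : K; _ : fixed_val \in fixed_pred}.

HB.instance Definition _ := [isSub for fixed_val].
HB.instance Definition _ := [Choice of fixed by <:].
HB.instance Definition _ := [SubChoice_isSubComUnitRing of fixed by <:].
HB.instance Definition _ := [SubComUnitRing_isSubIntegralDomain of fixed by <:].
HB.instance Definition _ := [SubIntegralDomain_isSubField of fixed by <:].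
HB.instance Definition _ := [SubZmodule_isSubLmodule of fixed by <:].
HB.instance Definition _ := [SubNzRing_SubLmodule_isSubLalgebra of fixed by <:].
HB.instance Definition _ := [SubLalgebra_isSubAlgebra of fixed by <:].

Fact fixed_der_subproof (a : fixed) : D (val a) \in fixed_pred.
Proof.
by apply/fixed_predP => g; rewrite aut_der; have /fixed_predP -> := valP a.
Qed.

Definition fixed_der_fun (a : fixed) : fixed := Fixed (fixed_der_subproof a).

Fact fixed_der_linear : linear fixed_der_fun.
Proof. by move=> c a b; apply: val_inj; rewrite /= der_linear. Qed.

Fact fixed_derM a b :
  fixed_der_fun (a * b) = fixed_der_fun a * b + a * fixed_der_fun b.
Proof. by apply: val_inj; rewrite /= derM. Qed.

Definition fixed_der : derivation fixed :=
  Derivation fixed_der_linear fixed_derM.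

End FixedField.

(* A formal series [\sum_e f_e x^e] with rational exponents and coefficients in
   [V] is the function [f : rat -> V] giving the coefficient of [x^e].
   [bilateral p f]: [f] lies in [V[[x^(1/p), x^(-1/p)]]];
   [laurent p f]: [f] lies in [V((x^(1/p)))]. *)
Definition bilateral (V : zmodType) (p : nat) (f : rat -> V) : Prop :=
  forall e, f e != 0 -> e * p%:R \is a Num.int.

Definition laurent (V : zmodType) (p : nat) (f : rat -> V) : Prop :=
  bilateral p f /\ exists N : rat, forall e, e < N -> f e = 0.

Definition gbinom (C : fieldType) (m : rat) (i : nat) : C :=
  (\prod_(k < i) (ratr m - k%:R)) / (i`!)%:R.

(* The mode [a_j] of the vertex algebra [(A, D)]; recall that [Negz i] is
   [- 1 - i]. *)
Definition va_mode (C : fieldType) (A : comAlgType C) (D : derivation A)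
    (j : int) (a b : A) : A :=
  match j with
  | Posz _ => 0
  | Negz i => ((i`!)%:R^-1 : C) *: (iter i D a * b)
  end.

(* The operator [a_i], i.e. the coefficient of [x^(- i - 1)] in [Y(a, x)]. *)
Definition mode (C : fieldType) (A : comAlgType C) (M : vectType C)
    (Y : A -> rat -> 'End(M)) (a : A) (i : rat) : 'End(M) := Y a (- i - 1).

Definition eigen (C : fieldType) (A : comAlgType C) (zeta : nat -> C)
    (g : A -> A) (p r : nat) (a : A) : Prop := g a = zeta p ^+ r *: a.

(* [in_coset p r m]: [m] lies in [r/p + Z]. *)
Definition in_coset (p r : nat) (m : rat) : Prop :=
  m - r%:R / p%:R \is a Num.int.

(* Finite-dimensional [g]-twisted vertex algebra [(A, D)]-modules, where [g] is
   an automorphism of [(A, D)] of order [p]. In the Jacobi identity both sides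
   are evaluated at [w : M]; all the sums then have finite support, as
   [va_mode D j u v = 0] for [j >= 0] and by [tw_trunc], so that they are the
   intended ones although [\sum_(i \in A) F i] is 0 for an infinite support. *)
Record twisted_module (C : fieldType) (A : comAlgType C) (D : derivation A)
    (zeta : nat -> C) (g : A -> A) (p : nat) (M : vectType C)
    (Y : A -> rat -> 'End(M)) : Prop := TwistedModule {
  tw_linear : forall e, linear (fun a => Y a e);
  tw_bilateral : forall a, bilateral p (Y a);
  tw_grading : forall r u, (r < p)%N -> eigen zeta g p r u ->
    forall i, mode Y u i != 0 -> in_coset p r i;
  tw_trunc : forall u (w : M), laurent p (fun e => Y u e w);
  tw_vacuum : forall e, Y 1 e = if e == 0 then \1%VF else 0;
  tw_jacobi : forall (r s : nat) (u v : A) (m n : rat) (l : int) (w : M),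
    (r < p)%N -> (s < p)%N ->
    eigen zeta g p r u -> eigen zeta g p s v ->
    in_coset p r m -> in_coset p s n ->
    \sum_(i \in [set: nat])
       gbinom C m i *:
         mode Y (va_mode D (l + i%:Z) u v) (m + n - i%:R) w
    = \sum_(i \in [set: nat])
       (gbinom C l%:~R i * (-1) ^+ i) *:
         (mode Y u (l%:~R + m - i%:R) (mode Y v (n + i%:R) w)
          + ((-1) ^ (l + 1)) *:
            mode Y v (l%:~R + n - i%:R) (mode Y u (m + i%:R) w))
}.

Definition va_module (C : fieldType) (A : comAlgType C) (D : derivation A)
    (zeta : nat -> C) (M : vectType C) (Y : A -> rat -> 'End(M)) : Prop :=
  twisted_module D zeta id 1 Y.

Definition submodule (C : fieldType) (A : comAlgType C) (M : vectType C)
    (Y : A -> rat -> 'End(M)) (U : {vspace M}) : Prop :=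
  forall a e, (Y a e @: U <= U)%VS.

Definition indecomposable (C : fieldType) (A : comAlgType C) (M : vectType C)
    (Y : A -> rat -> 'End(M)) : Prop :=
  forall U V : {vspace M}, submodule Y U -> submodule Y V ->
    (U + V = fullv)%VS -> (U :&: V = 0)%VS -> U = 0%VS \/ V = 0%VS.

Definition module_iso (C : fieldType) (A : comAlgType C) (M N : vectType C)
    (Y : A -> rat -> 'End(M)) (Z : A -> rat -> 'End(N)) : Prop :=
  exists f : 'Hom(M, N), bijective f /\
    forall a e, (f \o Y a e)%VF = (Z a e \o f)%VF.

Definition structure_over (C : fieldType) (K : fieldAlgType C)
    (D : derivation K) (G : finGroupType) (act : autGroup D G)
    (zeta : nat -> C) (M : vectType C) (Y : fixed act -> rat -> 'End(M))
    (g : G) (Yt : K -> rat -> 'End(M)) : Prop :=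
  [/\ twisted_module D zeta (act g) #[g]%g Yt,
      forall a, laurent #[g]%g (Yt a) &
      forall a : fixed act, Yt (val a) =1 Y a].

Definition twist (C : fieldType) (K : fieldAlgType C) (D : derivation K)
    (G : finGroupType) (act : autGroup D G) (M : vectType C)
    (Y : K -> rat -> 'End(M)) (h : G) : K -> rat -> 'End(M) :=
  fun a => Y (act h a).

(* [C]-algebra homomorphisms from [A] to [(End M)((x^(1/p)))]. The Cauchy
   product is a sum over [d : rat], of finite support for Laurent series. *)
Record laurent_hom (C : fieldType) (A : comAlgType C) (M : vectType C)
    (p : nat) (Y : A -> rat -> 'End(M)) : Prop := LaurentHom {
  lh_laurent : forall a, laurent p (Y a);
  lh_linear : forall e, linear (fun a => Y a e);
  lh_one : forall e, Y 1 e = if e == 0 then \1%VF else 0;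
  lh_mul : forall a b e,
    Y (a * b) e = \sum_(d \in [set: rat]) (Y a d \o Y b (e - d))%VF
}.

Record subalgebra (C : fieldType) (M : vectType C) (S : set 'End(M)) : Prop :=
  Subalgebra {
  sa_one : S \1%VF;
  sa_lin : forall (c : C) X Y, S X -> S Y -> S (c *: X + Y);
  sa_mul : forall X Y, S X -> S Y -> S (X \o Y)%VF
}.

Definition coef_alg (C : fieldType) (A : comAlgType C) (M : vectType C)
    (Y : A -> rat -> 'End(M)) : set 'End(M) :=
  smallest (@subalgebra C M) [set X | exists a e, X = Y a e].

Section CommutativeSubalgebra.
Context (C : fieldType) (M : vectType C) (S : set 'End(M)).

Record ideal (I : set 'End(M)) : Prop := Ideal {
  id_sub : I `<=` S;
  id_zero : I 0;
  id_add : forall X Y, I X -> I Y -> I (X + Y);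
  id_mul : forall X Y, S X -> I Y -> I (X \o Y)%VF /\ I (Y \o X)%VF
}.

Definition maximal_ideal (I : set 'End(M)) : Prop :=
  [/\ ideal I, I != S &
      forall J, ideal J -> I `<=` J -> J != S -> J = I].

(* Intersection of the maximal ideals; the Jacobson radical of [S] when [S] is
   a commutative subalgebra of [End M]. *)
Definition jacobson : set 'End(M) :=
  [set X | S X /\ forall I, maximal_ideal I -> I X].

Definition idempotent (X : 'End(M)) : Prop := S X /\ (X \o X)%VF = X.

Definition primitive_idempotent (X : 'End(M)) : Prop :=
  [/\ idempotent X, X != 0 &
      forall X1 X2, idempotent X1 -> idempotent X2 ->
        (X1 \o X2)%VF = 0 -> (X2 \o X1)%VF = 0 -> X = X1 + X2 ->
        X1 = 0 \/ X2 = 0].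

(* [c = (c_1, ..., c_m)] are coordinates of [X] modulo the radical along
   [es = (e_1, ..., e_m)]. *)
Definition idem_coords (es : seq 'End(M)) (X : 'End(M)) (c : seq C) : Prop :=
  size c = size es /\ jacobson (X - \sum_(i < size es) c`_i *: es`_i).

(* [e_1, ..., e_m] are primitive orthogonal idempotents such that [S] is the
   direct sum of the [C e_i] and of its radical. *)
Definition idem_system (es : seq 'End(M)) : Prop :=
  [/\ {in es, forall X, primitive_idempotent X},
      forall i j, (i < size es)%N -> (j < size es)%N -> i != j ->
        (es`_i \o es`_j)%VF = 0 &
      forall X, S X -> exists! c : seq C, idem_coords es X c].

(* For commutative [S] the system is unique up to order. *)
Definition idems : seq 'End(M) := xget [::] idem_system.

(* [X |-> X^[0]], with values in [C^m] where [m = size idems]. *)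
Definition semisimple_part (X : 'End(M)) : seq C :=
  xget [::] (idem_coords idems X).

End CommutativeSubalgebra.

(* [psi Y a e] is the coefficient of [x^e], a vector in [C^m], of the image of
   [a] under the homomorphism [psi[A, (M, Y)]]. *)
Definition psi (C : fieldType) (A : comAlgType C) (M : vectType C)
    (Y : A -> rat -> 'End(M)) (a : A) (e : rat) : seq C :=
  semisimple_part (coef_alg Y) (Y a e).

(* Main.v *)
(* By the Jacobi identity, a finite-dimensional [g]-twisted module is the same as a
   homomorphism of differential algebras [z : K -> S((x^(1/p)))], with [S] a
   commutative algebra of endomorphisms of [M], such that [z (g u)] is the image of
   [z u] under the monodromy [x^(1/p) |-> zeta_p^-1 x^(1/p)]. Let [S] be the algebra
   generated by the modes of [Y]. As [M] is indecomposable, [S] is local with residue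
   field [C], and the kernel of [S((x^(1/p))) -> C((x^(1/p)))] is nilpotent. The
   extension [K / K^G] being Galois, hence etale, the extensions to [K] of
   [K^G -> S((x))] correspond to the extensions of its residue [K^G -> C((x))]. These
   exist, since Puiseux series over [C] are algebraically closed, and [G] permutes
   them transitively. Applied to the monodromy of an extension, transitivity yields
   the twist [g]. *)

Require Import Defs.
From HB Require Import structures.
From mathcomp Require Import all_boot all_order all_algebra all_fingroup.
From mathcomp Require Import boolp classical_sets functions cardinality fsbigop.
From mathcomp Require Import reals complex.
From mathcomp Require Import cyclic ring lra zify.

Set Implicit Arguments.
Unset Strict Implicit.
Unset Printing Implicit Defensive.

Import Order.TTheory GRing.Theory Num.Theory.

Local Open Scope ring_scope.

(** * Puiseux series *)

(** The exponents are rationals, so that all denominators live in one ring and [p] can be determined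
    afterwards, as the least common denominator of an extension; it exists because [K] is generated
    over [K^G] by one element. In the Jacobi identity [l = 0] gives commutativity of the modes,
    [l = -1] multiplicativity, and [l = -2] with [v = 1] the compatibility with [D]; the converse
    rests on the Chu-Vandermonde identity. An extension is compatible with [D] because its defect is
    a derivation of [K] that vanishes on [K^G]. The obstacle is that two structures generate a
    priori different algebras of endomorphisms. Lifting the residue of a structure to the algebra
    [S] of [Y] and comparing inside the larger algebra shows that no new coefficient appears. All
    structures are then morphisms to one ring, and the isomorphisms of (2) and (4) are equalities,
    given by the identity of [M]. *)

Section SeqConv.
Variable A : comNzRingType.
Implicit Types a b c : nat -> A.

Definition sconv a b : nat -> A := fun k => \sum_(i < k.+1) a i * b (k - i)%N.

(** Truncation to polynomials: the laws of the Cauchy product are inherited from those of polynomial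
    multiplication. *)
Lemma sconv_poly a b k n : (k < n)%N ->
  sconv a b k = ((\poly_(i < n) a i) * (\poly_(i < n) b i))`_k.
Proof.
move=> kn; rewrite coefM; apply: eq_bigr => i _; rewrite !coef_poly.
by rewrite (leq_ltn_trans _ kn) ?(leq_ltn_trans (leq_subr _ _) kn) // -ltnS.
Qed.

Lemma sconvC a b : sconv a b = sconv b a.
Proof. by apply/funext => k; rewrite !(sconv_poly _ _ (ltnSn k)) mulrC. Qed.

Lemma sconvA a b c : sconv a (sconv b c) = sconv (sconv a b) c.
Proof.
apply/funext => k; rewrite !(sconv_poly _ _ (ltnSn k)).
have lt i : (i < k.+1)%N -> forall f g : nat -> A,
    (\poly_(i < k.+1) sconv f g i)`_i
    = ((\poly_(i < k.+1) f i) * (\poly_(i < k.+1) g i))`_i.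
  by move=> ik f g; rewrite coef_poly ik (sconv_poly _ _ ik).
transitivity ((\poly_(i < k.+1) a i) * ((\poly_(i < k.+1) b i)
   * (\poly_(i < k.+1) c i)))`_k.
  rewrite !coefM; apply: eq_bigr => i _.
  by rewrite lt // ltnS leq_subr.
rewrite mulrA coefM [RHS]coefM; apply: eq_bigr => i _.
by rewrite lt.
Qed.

End SeqConv.

Section Puiseux.
Variable A : comNzRingType.
Implicit Types f g h : rat -> A.

(** Denominator and truncation are one condition with a natural index [k], so that a series on a
    grid amounts to a sequence [nat -> A]. *)
Definition grid (p N : nat) f :=
  forall e, f e != 0 -> exists k : nat, e = (k%:R - N%:R) / p%:R.

Definition pfun f := exists p N, (0 < p)%N /\ grid p N f.

(** The slack [m] serves to bring two refined grids to the same offset. *)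
Lemma grid_dvd p N q m f : (0 < p)%N -> (0 < q)%N ->
  grid p N f -> grid (p * q) (N * q + m) f.
Proof.
move=> p0 q0 gf e /gf [k ->]; exists (k * q + m)%N.
have := p0; have := q0; rewrite !lt0n -!(eqr_nat rat) => qn pn.
rewrite !natrD !natrM; field.
by rewrite qn pn.
Qed.

Lemma grid_common f g : pfun f -> pfun g ->
  exists p N, [/\ (0 < p)%N, grid p N f & grid p N g].
Proof.
move=> [p [N [p0 gf]]] [q [N' [q0 gg]]].
exists (p * q)%N, (N * q + N' * p)%N; split; first by rewrite muln_gt0 p0.
  exact: grid_dvd.
by rewrite mulnC addnC; apply: grid_dvd.
Qed.

Fact pfun_zmod : zmod_closed [pred f : rat -> A | `[< pfun f >]].
Proof.
split=> [|f g].
  by apply/asboolP; exists 1%N, 0%N; split=> // e; rewrite eqxx.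
move=> /asboolP pf /asboolP pg; apply/asboolP.
have [p [N [p0 gf gg]]] := grid_common pf pg.
exists p, N; split=> // e fe.
have [fe0|] := eqVneq (f e) 0; last exact: gf.
apply: gg; apply: contraNneq fe => ge0.
by change (f e - g e == 0); rewrite fe0 ge0 subrr.
Qed.

HB.instance Definition _ :=
  GRing.isZmodClosed.Build (rat -> A) [pred f : rat ->
    A | `[< pfun f >]] pfun_zmod.

Record puiseux := Puiseux {coef : rat -> A;
   _ : coef \in [pred f : rat -> A | `[< pfun f >]]}.

HB.instance Definition _ := [isSub for coef].
HB.instance Definition _ := [Choice of puiseux by <:].
HB.instance Definition _ := [SubChoice_isSubZmodule of puiseux by <:].

Implicit Types u v w : puiseux.

Lemma coefP u : pfun (coef u).
Proof. by apply/asboolP; case: u. Qed.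

Lemma coef_inj u v : coef u =1 coef v -> u = v.
Proof. by move=> /funext uv; apply: val_inj. Qed.

Lemma coefpB u v e : coef (u - v) e = coef u e - coef v e. Proof. by []. Qed.
Lemma coefpD u v e : coef (u + v) e = coef u e + coef v e. Proof. by []. Qed.
Lemma coefp0 e : coef 0 e = 0. Proof. by []. Qed.

(* The series [\sum_k a_k x^((k - N) / p)]. *)
Definition ser (p N : nat) (a : nat -> A) : rat -> A :=
  fun e => let m := e * p%:R + N%:R in
    if m \is a Num.nat then a (Num.truncn m) else 0.

Lemma serE p N a k : (0 < p)%N -> ser p N a ((k%:R - N%:R) / p%:R) = a k.
Proof.
rewrite lt0n -(eqr_nat rat) => p0; rewrite /ser divfK // subrK.
by rewrite natr_nat natrK.
Qed.

Lemma ser_grid p N a : (0 < p)%N -> grid p N (ser p N a).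
Proof.
move=> p0 e; rewrite /ser; case: ifP => [/natrP[k ek] _|_];
  last by rewrite eqxx.
exists k; rewrite -ek addrK mulfK //.
by rewrite pnatr_eq0 -lt0n.
Qed.

Lemma grid_ser p N f : (0 < p)%N -> grid p N f ->
  f = ser p N (fun k => f ((k%:R - N%:R) / p%:R)).
Proof.
move=> p0 gf; apply/funext => e; rewrite /ser.
case: ifP => [/natrP[k ek]|].
  rewrite ek natrK -ek addrK mulfK //.
  by rewrite pnatr_eq0 -lt0n.
have [//|/gf [k ->]] := eqVneq (f e) 0.
by rewrite divfK ?subrK ?natr_nat // pnatr_eq0 -lt0n.
Qed.

(** For arbitrary functions the support may be infinite and the sum is then 0 by convention; on a
    common grid [pconv_ser] gives its true value. *)
Definition pconv f g : rat ->
  A := fun e => \sum_(d \in [set: rat]) f d * g (e - d).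

Lemma finsum_seq (V : nmodType) (T : choiceType) (r : seq T) (F : T -> V) :
  uniq r -> (forall i, F i != 0 -> i \in r) ->
  \sum_(i \in [set: T]) F i = \sum_(i <- r) F i.
Proof.
move=> ur Fr; rewrite (@fsbigE _ _ _ _ _ r) //.
- by apply: eq_bigl => i; rewrite in_setT.
- by move=> i _ ir; apply/eqP; apply: contraNT ir; apply: Fr.
Qed.

(** Transfers the ring axioms from sequences to Puiseux series, since finitely many series share a
    grid. *)
Lemma pconv_ser p N N' a b : (0 < p)%N ->
  pconv (ser p N a) (ser p N' b) = ser p (N + N') (sconv a b).
Proof.
move=> p0; have p0' : p%:R != 0 :> rat by rewrite pnatr_eq0 -lt0n.
apply/funext => e; rewrite /pconv.
have [ek|nk] := boolP (e * p%:R + (N + N')%:R \is a Num.nat); last first.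
  rewrite /ser (negbTE nk) fsbig1 // => d _.
  case: ifP => [dn|]; last by rewrite mul0r.
  case: ifP => [en|]; last by rewrite mulr0.
  case/negP: nk.
  have -> : e * p%:R + (N + N')%:R = (d * p%:R + N%:R) + ((e - d)
    * p%:R + N'%:R).
    by rewrite natrD; ring.
  by rewrite rpredD.
move/natrP: ek => [k ek].
have -> : e = (k%:R - (N + N')%:R) / p%:R by rewrite -ek addrK mulfK.
rewrite serE //.
pose q (i : nat) : rat := (i%:R - N%:R) / p%:R.
have qI : injective q.
  move=> i j /(congr1 (fun x => x * p%:R + N%:R)); rewrite !divfK // !subrK.
  by move/eqP; rewrite eqr_nat => /eqP.
(* Grid points of index above [k] contribute nothing: there the second factor is evaluated below its
   grid. *)
rewrite (@finsum_seq _ _ [seq q i | i <- iota 0 k.+1]); last first.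
- move=> d; have [->|/(ser_grid p0) [i ->] nz] := eqVneq (ser p N a d) 0.
    by rewrite mul0r eqxx.
  apply/mapP; exists i => //; rewrite mem_iota /= add0n.
  case: ltnP => // ki; case/eqP: nz.
  rewrite [X in _ * X](_ : _ = 0) ?mulr0 //; apply/eqP.
  apply: contraT => /(ser_grid p0)[j].
  move/(congr1 (fun x => x * p%:R + N'%:R));
    rewrite mulrBl !divfK // subrK natrD.
  move=> /eqP; have -> : k%:R - (N%:R + N'%:R) - (i%:R - N%:R)
    + N'%:R = k%:R - i%:R :> rat.
    by ring.
  rewrite subr_eq -natrD eqr_nat => /eqP kij.
  by move: ki; rewrite kij; lia.
- by rewrite map_inj_uniq ?iota_uniq.
rewrite big_map -[iota 0 k.+1]/(index_iota 0 k.+1) big_mkord.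
apply: eq_bigr => i _; rewrite /q serE //; congr (_ * _).
have -> : (k%:R - (N + N')%:R) / p%:R - (i%:R - N%:R) / p%:R
   = ((k - i)%N%:R - N'%:R) / p%:R :> rat.
  by rewrite natrD natrB ?leq_ord // -1?ltnS //; field.
by rewrite serE.
Qed.

Lemma pconv_grid p N N' f g : (0 < p)%N -> grid p N f -> grid p N' g ->
  grid p (N + N') (pconv f g).
Proof.
move=> p0 gf gg; rewrite (grid_ser p0 gf) (grid_ser p0 gg) pconv_ser //.
exact: ser_grid.
Qed.

Lemma pconv_pfun f g : pfun f -> pfun g -> pfun (pconv f g).
Proof.
move=> pf pg; have [p [N [p0 gf gg]]] := grid_common pf pg.
by exists p, (N + N)%N; split=> //; apply: pconv_grid.
Qed.

Fact pmul_subproof u v :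
  pconv (coef u) (coef v) \in [pred f : rat -> A | `[< pfun f >]].
Proof. by apply/asboolP; apply: pconv_pfun; apply: coefP. Qed.

Definition pmul u v := Puiseux (pmul_subproof u v).

Lemma ser_pfun p N a : (0 < p)%N -> 
  ser p N a \in [pred f : rat -> A | `[< pfun f >]].
Proof. by move=> p0; apply/asboolP; exists p, N; split=> //;
  apply: ser_grid. Qed.

Lemma ser_mono d a : (fun e => if e == d then a else 0 : A)
  \in [pred f : rat -> A | `[< pfun f >]].
Proof.
(* The offset [|numq d|] keeps the index [numq d + |numq d|] nonnegative. *)
apply/asboolP; exists (`|denq d|%N), (`|numq d|)%N; split.
  by rewrite absz_gt0 denq_neq0.
move=> e; have [->|_] := eqVneq e d; last by rewrite eqxx.
move=> _; exists `|(numq d + `|numq d|%N%:Z)%R|%N.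
have den : `|denq d|%N%:R = (denq d)%:~R :> rat by rewrite natr_absz normr_denq.
rewrite den -{1}[d]divq_num_den; congr (_ / _).
rewrite !natr_absz ger0_norm; last by lia.
by rewrite rmorphD /= addrK.
Qed.

Definition mono d a : puiseux := Puiseux (ser_mono d a).

Lemma mono_coef d a e : coef (mono d a) e = if e == d then a else 0.
Proof. by []. Qed.

Lemma pconv_mono f d a e : pconv (coef (mono d a)) f e = a * f (e - d).
Proof.
rewrite /pconv (@finsum_seq _ _ [:: d]) // ?big_seq1 ?mono_coef ?eqxx //.
by move=> i; rewrite mono_coef inE; case: (i == d) => //; rewrite mul0r eqxx.
Qed.

Lemma pmulC : commutative pmul.
Proof.
move=> u v; apply: val_inj => /=.
have [p [N [p0 gu gv]]] := grid_common (coefP u) (coefP v).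
by rewrite (grid_ser p0 gu) (grid_ser p0 gv) !pconv_ser // sconvC.
Qed.

Lemma grid_common3 f g h : pfun f -> pfun g -> pfun h ->
  exists p N, [/\ (0 < p)%N, grid p N f, grid p N g & grid p N h].
Proof.
move=> pf pg [p' [N' [p0' gh]]].
have [p [N [p0 gf gg]]] := grid_common pf pg.
exists (p * p')%N, (N * p' + N' * p)%N; split; first by rewrite muln_gt0 p0.
- exact: grid_dvd.
- exact: grid_dvd.
by rewrite mulnC addnC; apply: grid_dvd.
Qed.

Lemma pmulA : associative pmul.
Proof.
move=> u v w; apply: val_inj => /=.
have [p [N [p0 gu gv gw]]] := grid_common3 (coefP u) (coefP v) (coefP w).
rewrite (grid_ser p0 gu) (grid_ser p0 gv) (grid_ser p0 gw) !pconv_ser //.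
by rewrite sconvA addnA.
Qed.

Lemma pmul1 : left_id (mono 0 1) pmul.
Proof. by move=> u; apply: coef_inj => e /=;
  rewrite pconv_mono mul1r subr0. Qed.

Lemma pmulDl : left_distributive pmul +%R.
Proof.
move=> u v w; apply: coef_inj => e.
have [p [N [p0 gu gv gw]]] := grid_common3 (coefP u) (coefP v) (coefP w).
have guv : grid p N (coef (u + v)).
  move=> d; rewrite coefpD => nz.
  have [ud0|] := eqVneq (coef u d) 0; last exact: gu.
  by apply: gv; rewrite ud0 add0r in nz.
rewrite coefpD -[LHS]/(pconv (coef (u + v)) (coef w) e).
rewrite -[RHS]/(pconv (coef u) (coef w) e + pconv (coef v) (coef w) e).
rewrite (grid_ser p0 guv) (grid_ser p0 gu) (grid_ser p0 gv) (grid_ser p0 gw).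
rewrite !pconv_ser // /ser; case: ifP; rewrite ?addr0 // => _.
by rewrite /sconv -big_split /=; apply: eq_bigr => i _; rewrite mulrDl.
Qed.

Lemma mono_neq0 : mono 0 1 != 0.
Proof.
by apply/eqP => /(congr1 (fun u => coef u 0)) /eqP;
  rewrite mono_coef eqxx oner_eq0.
Qed.

HB.instance Definition _ := GRing.Zmodule_isComNzRing.Build puiseux
  pmulA pmulC pmul1 pmulDl mono_neq0.

Lemma coefpM u v : coef (u * v) = pconv (coef u) (coef v). Proof. by []. Qed.
Lemma coefp1 e : coef 1 e = if e == 0 then 1 else 0. Proof. by []. Qed.

Lemma coef_monoM d a u e : coef (mono d a * u) e = a * coef u (e - d).
Proof. exact: pconv_mono. Qed.

Lemma monoM d a d' a' : mono d a * mono d' a' = mono (d + d') (a * a').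
Proof.
apply: coef_inj => e; rewrite coef_monoM !mono_coef.
by rewrite subr_eq addrC; case: eqP => //; rewrite mulr0.
Qed.

Lemma monoD d a b : mono d (a + b) = mono d a + mono d b.
Proof.
by apply: coef_inj => e; rewrite coefpD !mono_coef; case: eqP; rewrite ?addr0.
Qed.

Lemma mono00 d : mono d 0 = 0.
Proof. by apply: coef_inj => e; rewrite mono_coef if_same. Qed.

Lemma mono1 : mono 0 1 = 1. Proof. by []. Qed.

(** Exponents on a grid are indexed by natural numbers, so the least one is attained: this is the
    valuation. *)
Lemma exists_val u : u != 0 ->
  exists v : rat, coef u v != 0 /\ forall e, coef u e != 0 -> v <= e.
Proof.
move=> u0; have [p [N [p0 gu]]] := coefP u.
have [e0 ue0] : exists e, coef u e != 0.
  apply: contrapT => none; case/eqP: u0; apply: coef_inj => e.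
  by apply/eqP; apply: contraT => ue; case: none; exists e.
have p0' : 0 < p%:R :> rat by rewrite ltr0n.
have exk : exists k : nat, coef u ((k%:R - N%:R) / p%:R) != 0.
  by have [k ek] := gu _ ue0; exists k; rewrite -ek.
case: (ex_minnP exk) => k uk kmin.
exists ((k%:R - N%:R) / p%:R); split=> // e ue.
have [j ej] := gu _ ue; rewrite ej ler_pM2r ?invr_gt0 // lerD2r ler_nat kmin //.
by rewrite -ej.
Qed.

End Puiseux.

Section Denominators.
Variable A : comNzRingType.
Implicit Types u v : puiseux A.

(* [u] lies in [A((x^(1/p)))]. *)
Definition has_denom (p : nat) u := forall e, coef u e != 0 ->
  e * p%:R \is a Num.int.

Lemma denom0 p : has_denom p 0.
Proof. by move=> e; rewrite coefp0 eqxx. Qed.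

Lemma denomD p u v : has_denom p u -> has_denom p v -> has_denom p (u + v).
Proof.
move=> du dv e; rewrite coefpD => nz.
have [ue|/du//] := eqVneq (coef u e) 0.
by apply: dv; rewrite ue add0r in nz.
Qed.

Lemma denomM p u v : has_denom p u -> has_denom p v -> has_denom p (u * v).
Proof.
move=> du dv e; apply: contraR => ne; rewrite coefpM /pconv fsbig1 // => d _.
have [->|/du di] := eqVneq (coef u d) 0; first by rewrite mul0r.
have [->|/dv ei] := eqVneq (coef v (e - d)) 0; first by rewrite mulr0.
by case/negP: ne; rewrite -[e](subrK d) mulrDl rpredD.
Qed.

Lemma denom_dvd p q u : (p %| q)%N -> has_denom p u -> has_denom q u.
Proof.
by move=> /dvdnP[k ->] du e /du h; rewrite natrM mulrCA rpredM // natr_int.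
Qed.

Lemma exists_denom u : exists2 p, (0 < p)%N & has_denom p u.
Proof.
have [p [N [p0 gu]]] := coefP u; exists p => // e /gu[k ->].
by rewrite divfK ?pnatr_eq0 -?lt0n // rpredB // natr_int.
Qed.

Lemma denom_horner p (f : {poly puiseux A}) t :
  (forall i, has_denom p f`_i) -> has_denom p t -> has_denom p f.[t].
Proof.
move=> df dt; rewrite horner_coef; apply: (big_ind (has_denom p)).
- exact: denom0.
- exact: denomD.
move=> i _; apply: denomM => //.
elim: (nat_of_ord i) => [|k IH]; last by rewrite exprS; apply: denomM.
move=> e; rewrite expr0 coefp1; case: (e =P 0) => [-> _|_];
  last by rewrite eqxx.
by rewrite mul0r.
Qed.

End Denominators.

(** * Newton-Puiseux theorem *)

(** The earlier values are accumulated in a list; by the hypothesis on [step] the default [x0]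
    beyond the end of the list never influences the result. *)
Lemma course_of_values (T : Type) (x0 : T) (step : nat -> (nat -> T) -> T) :
  (forall k s s', (forall i, (i < k)%N -> s i = s' i) ->
    step k s = step k s') ->
  exists s : nat -> T, forall k, s k = step k s.
Proof.
move=> stepE.
pose fix pre k := if k is k'.+1 then rcons (pre k') (step k' (nth x0 (pre k')))
  else [::].
have szpre k : size (pre k) = k by elim: k => //= k IH; rewrite size_rcons IH.
pose s k := step k (nth x0 (pre k)).
have nthpre k i : (i < k)%N -> nth x0 (pre k) i = s i.
  elim: k => // k IH; rewrite ltnS leq_eqVlt /= nth_rcons szpre.
  by case: ltngtP => // [ik _|-> _]; rewrite ?IH.
by exists s => k; apply: stepE => i /nthpre.
Qed.

Lemma size_add_leq (R : nzRingType) (p q : {poly R}) n :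
  (size p <= n)%N -> (size q <= n)%N -> (size (p + q)%R <= n)%N.
Proof.
by move=> pn qn; apply: leq_trans (size_polyD _ _) _; rewrite geq_max pn.
Qed.

Section Hensel.
Variable C : fieldType.

(* Hensel factorization with [f k], [g k], [h k] the coefficients of [t^k]: each
   step solves [g0 * h k + g k * h0 = r] by Bezout. *)
Lemma hensel_seq (f : nat -> {poly C}) (g0 h0 : {poly C}) :
  f 0%N = g0 * h0 -> g0 != 0 -> h0 != 0 -> coprimep g0 h0 ->
  (forall k, (0 < k)%N -> (size (f k) < (size g0 + size h0).-1)%N) ->
  exists g h : nat -> {poly C}, [/\ g 0%N = g0, h 0%N = h0,
    forall k, (0 < k)%N -> (size (g k) < size g0)%N,
    forall k, (0 < k)%N -> (size (h k) < size h0)%N &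
    forall k, f k = sconv g h k].
Proof.
have ar1 a b c d : (a < c -> b < d -> (a + b).-1 <= (c + d).-2)%N by lia.
have ar2 a b : (a < b.-1 -> a <= b.-2)%N by lia.
have ar3 a b c : (a < b -> 0 < c -> (a + c).-1 <= (b + c).-2)%N by lia.
have ar4 a b c : (0 < a -> 0 < b -> 0 < c -> (a + b).-1 <= (a + c).-2 ->
  b < c)%N.
  by lia.
move=> f0 g00 h00 /Bezout_eq1_coprimepP[[a b] /= abE] fk.
(* The two end terms of the convolution, which hold the unknowns [g k] and [h k], are left out. *)
pose rem k (s : nat -> {poly C} * {poly C}) :=
  f k - \sum_(1 <= i < k) (s i).1 * (s (k - i)%N).2.
(* Reduction modulo [g0] keeps the degree of [g k] below that of [g0]; the quotient is moved over to
   [h k]. *)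
pose step k s := if k is 0%N then (g0, h0) else
  let r := rem k s in
  ((b * r) %% g0, a * r + (b * r) %/ g0 * h0).
have [|s sE] := course_of_values (0, 0) (step := step).
  case=> // k s s' ss'; rewrite /step.
  suff -> : rem k.+1 s = rem k.+1 s' by [].
  rewrite /rem; congr (_ - _); apply: eq_big_nat => i /andP[i0 ik].
  by rewrite !ss' // ltn_subrL i0.
have s0 : s 0%N = (g0, h0) by rewrite sE.
have eqk k : (0 < k)%N -> g0 * (s k).2 + (s k).1 * h0 = rem k s.
  case: k => // k _; rewrite sE /step /=; set r := rem _ _.
  have := divp_eq (b * r) g0; set q := _ %/ _; set m := _ %% _ => e.
  transitivity (g0 * a * r + (q * g0 + m) * h0); first by ring.
  by rewrite -e -[RHS]mul1r -abE; ring.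
have szgh k : (0 < k)%N -> (size (s k).1 < size g0)%N /\ (size (s k).2 < size
  h0)%N.
  elim/ltn_ind: k => k IH k0.
  have szg : (size (s k).1 < size g0)%N.
    by case: k k0 {IH} => // k _; rewrite sE /= ltn_modp.
  split=> //.
  have [->|hk0] := eqVneq (s k).2 0; first by rewrite size_poly0 size_poly_gt0.
  have szr : (size (rem k s) <= (size g0 + size h0).-2)%N.
    apply: size_add_leq; first by move: (fk k k0); apply: ar2.
    rewrite size_polyN big_nat;
      apply: (big_ind (fun p : {poly C} =>
        (size p <= (size g0 + size h0).-2)%N)).
    - by rewrite size_poly0.
    - by move=> *; apply: size_add_leq.
    move=> i /andP[i0 ik].
    have [szi _] := IH i ik i0.
    have [||_ szj] := IH (k - i)%N; rewrite ?ltn_subrL ?i0 ?subn_gt0 //.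
    apply: leq_trans (size_polyMleq _ _) _.
    by apply: (ar1 _ _ _ _ szi szj).
  (* The degree of [h k] is read off from [g0 * h k = rem - g k * h0], whose right-hand side has
     degree less than [g0 * h0]. *)
  have := congr1 (fun p : {poly C} => size p) (canRL (addrK _) (eqk k k0)).
  rewrite size_mul // => szE.
  have szle : (size (rem k s - (s k).1 * h0)%R <= (size g0 + size h0).-2)%N.
    apply: size_add_leq => //; rewrite size_polyN.
    apply: leq_trans (size_polyMleq _ _) _.
    by apply: (ar3 _ _ _ szg); rewrite size_poly_gt0.
  by rewrite -szE in szle; apply: ar4 szle; rewrite size_poly_gt0.
exists (fun k => (s k).1), (fun k => (s k).2); split; rewrite ?s0 //.
- by move=> k /szgh[].
- by move=> k /szgh[].
case=> [|k].
  by rewrite /sconv big_ord_recl big_ord0 addr0 s0.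
rewrite /sconv -(big_mkord xpredT (fun i => (s i).1 * (s (k.+1 - i)%N).2)).
rewrite big_nat_recr // big_ltn //= subn0 subnn s0 /=.
have := eqk k.+1 isT; rewrite /rem => /esym/eqP; rewrite subr_eq => /eqP ->.
by ring.
Qed.

End Hensel.

Section NewtonPuiseux.
Variable C : numClosedFieldType.
Local Notation L := (puiseux C).

(** The denominator is [p.+1], hence positive without a hypothesis. *)
Definition pser p (a : nat -> C) : L := Puiseux (@ser_pfun C p.+1 0 a isT).

Lemma pserM p a b : pser p a * pser p b = pser p (sconv a b).
Proof. by apply: coef_inj => e; rewrite coefpM /= pconv_ser. Qed.

Lemma pserD p a b : pser p (fun k => a k + b k) = pser p a + pser p b.
Proof.
by apply: coef_inj => e; rewrite coefpD /= /ser; case: ifP; rewrite ?addr0.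
Qed.

Lemma pser0 p : pser p (fun=> 0) = 0.
Proof. by apply: coef_inj => e; rewrite /= /ser if_same. Qed.

Lemma pser1 p (a : nat -> C) : a 0%N = 1 -> (forall k, (0 < k)%N -> a k = 0) ->
  pser p a = 1.
Proof.
move=> a0 ak; apply: coef_inj => e; rewrite coefp1 /= /ser addr0.
case: ifP => [/natrP[k ek]|].
  rewrite ek natrK; case: (posnP k) => [k0|k0].
    rewrite k0 a0; move: ek; rewrite k0 => /eqP.
    by rewrite mulf_eq0 pnatr_eq0 orbF => ->.
  rewrite ak //; case: eqP => // e0; move/eqP: ek.
  by rewrite e0 mul0r eq_sym pnatr_eq0 eqn0Ngt k0.
by case: eqP => // ->; rewrite mul0r rpred0.
Qed.

Lemma pser_sum p (I : Type) (r : seq I) (F : I -> nat -> C) :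
  pser p (fun k => \sum_(i <- r) F i k) = \sum_(i <- r) pser p (F i).
Proof.
elim: r => [|i r IH].
  rewrite big_nil -[RHS](pser0 p); congr pser; apply/funext => k.
  by rewrite big_nil.
rewrite big_cons -IH -pserD; congr pser; apply/funext => k.
by rewrite big_cons.
Qed.

(** A polynomial over series, regrouped as a series of polynomials with [g k] in front of
    [x^(k/(p+1))]: the form to which [hensel_seq] applies. *)
Definition pserpoly p d (g : nat -> {poly C}) : {poly L} :=
  \poly_(j < d) pser p (fun k => (g k)`_j).

Lemma pserpoly_coef p d (g : nat ->
  {poly C}) j : (forall k, (size (g k) <= d)%N) ->
  (pserpoly p d g)`_j = pser p (fun k => (g k)`_j).
Proof.
move=> gd; rewrite coef_poly; case: ltnP => // dj.
rewrite -(pser0 p); congr pser; apply/funext => k.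
by rewrite nth_default // (leq_trans (gd k)).
Qed.

Lemma pserpolyM p d1 d2 d (g h : nat -> {poly C}) :
  (forall k, (size (g k) <= d1)%N) -> (forall k, (size (h k) <= d2)%N) ->
  (forall k, (size (sconv g h k) <= d)%N) ->
  pserpoly p d1 g * pserpoly p d2 h = pserpoly p d (sconv g h).
Proof.
move=> gd hd ghd; apply/polyP => j; rewrite coefM pserpoly_coef //.
under eq_bigr do rewrite !pserpoly_coef // pserM.
rewrite -pser_sum; congr pser; apply/funext => k.
rewrite /sconv coef_sum exchange_big /=; apply: eq_bigr => i _.
by rewrite coefM.
Qed.

(** Only the term of order 0 reaches the degree of [g0], so the leading coefficient is the constant
    series 1. *)
Lemma pserpoly_monic p (g0 : {poly C}) g :
  g 0%N = g0 -> g0 \is monic -> (forall k, (0 < k)%N ->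
    (size (g k) < size g0)%N) ->
  size (pserpoly p (size g0) g) = size g0 /\ pserpoly p (size g0) g \is monic.
Proof.
move=> g00 g0m gk.
have g0n : (0 < size g0)%N by rewrite size_poly_gt0 monic_neq0.
have top : pser p (fun k => (g k)`_(size g0).-1) = 1.
  apply: pser1 => [|k k0]; first by rewrite g00 -lead_coefE (monicP g0m).
  by rewrite nth_default // -ltnS prednK // gk.
have sz : size (pserpoly p (size g0) g) = size g0.
  rewrite -{2}(prednK g0n) /pserpoly -{1}(prednK g0n) size_poly_eq ?prednK //.
  by rewrite top oner_eq0.
split=> //; rewrite monicE lead_coefE sz coef_poly ltn_predL g0n top.
by [].
Qed.

Lemma hensel_factor p n (f : nat -> {poly C}) (g0 h0 : {poly C}) :
  f 0%N = g0 * h0 -> g0 \is monic -> h0 \is monic -> coprimep g0 h0 ->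
  size (f 0%N) = n.+1 -> (forall k, (0 < k)%N -> (size (f k) <= n)%N) ->
  exists g h : {poly L}, [/\ pserpoly p n.+1 f = g * h, g \is monic &
     size g = size g0].
Proof.
move=> f0 g0m h0m cop szf0 szf.
have g00 := monic_neq0 g0m; have h00 := monic_neq0 h0m.
have szE : (size g0 + size h0).-1 = n.+1 by rewrite -szf0 f0 size_mul.
have [|g [h [gE hE gk hk fE]]] := hensel_seq f0 g00 h00 cop.
  by move=> k k0; rewrite szE ltnS szf.
have [szg gm] := pserpoly_monic p gE g0m gk.
exists (pserpoly p (size g0) g), (pserpoly p (size h0) h); split=> //.
have fs : f = sconv g h by apply/funext.
rewrite fs -(@pserpolyM p (size g0) (size h0) n.+1) // => k; rewrite -?fs.
- by case: (posnP k) => [->|/gk/ltnW]; rewrite ?gE.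
- by case: (posnP k) => [->|/hk/ltnW]; rewrite ?hE.
by case: (posnP k) => [->|/szf/leqW]; rewrite ?szf0.
Qed.

Lemma common_denom n (F : 'I_n -> L) : exists p, forall j, has_denom p.+1 (F j).
Proof.
have exq j : exists q, (0 < q)%N /\ has_denom q (F j).
  by have [q q0 dq] := exists_denom (F j); exists q.
have [q qP] := choice exq.
have q0 : (0 < \prod_j q j)%N by apply: prodn_gt0 => j; case: (qP j).
exists (\prod_j q j).-1 => j; rewrite prednK //.
by apply: denom_dvd (qP j).2; rewrite (bigD1 j) //= dvdn_mulr.
Qed.

Lemma pserpoly_of_denom p n (F : 'I_n.+1 -> L) (P : {poly L}) :
  P = \poly_(j < n.+1) F (inord j) ->
  (forall j, has_denom p.+1 (F j)) ->
  (forall j e, coef (F j) e != 0 -> 0 <= e) ->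
  P = pserpoly p n.+1 (fun k =>
    \poly_(j < n.+1) coef (F (inord j)) (k%:R / p.+1%:R)).
Proof.
move=> -> dF F0; apply/polyP => j; rewrite pserpoly_coef; last first.
  by move=> k; apply: size_poly.
rewrite coef_poly; case: ifP => jn; last first.
  rewrite -(pser0 p); congr pser; apply/funext => k.
  by rewrite coef_poly jn.
apply: coef_inj => e /=.
have g : grid p.+1 0 (coef (F (inord j))).
  move=> d nz; have := dF _ _ nz; have := F0 _ _ nz => d0 /intrP[z dz].
  have z0 : 0 <= z by rewrite -(ler0z rat) -dz mulr_ge0.
  by exists `|z|%N; rewrite subr0 natr_absz ger0_norm // -dz mulfK ?pnatr_eq0.
rewrite {1}(grid_ser (p := p.+1) isT g); congr ser; apply/funext => k.
by rewrite coef_poly jn subr0.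
Qed.

(** Induction on the degree: the slope of the Newton polygon gives a residual polynomial over [C];
    the power of [X - c] at one of its roots has degree below [n] and lifts to a factor, which has a
    root by induction. *)
Lemma puiseux_root_rec n (f : {poly L}) : (0 < n)%N -> size f = n.+1 ->
  f \is monic -> exists x, root f x.
Proof.
elim/ltn_ind: n f => n IH f n0 szf fm.
have nC : n%:R != 0 :> C by rewrite pnatr_eq0 -lt0n.
have fn : f`_n = 1 by rewrite -(monicP fm) lead_coefE szf.
(* Tschirnhaus: translating by [s] kills the coefficient of degree [n - 1], so
   that after rescaling the residual polynomial is not a power of a single linear
   factor and Hensel's lemma gives a proper factorization. *)
pose s : L := mono 0 (- n%:R^-1) * f`_n.-1.
pose f1 j := (f^`N(j)).[s].
have f1n : f1 n = 1.
  rewrite /f1 (_ : f^`N(n) = 1) ?hornerC //; apply/polyP => i.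
  rewrite coef_nderivn coef1; case: i => [|i] /=; rewrite ?addn0 ?binn ?fn //.
  by rewrite nth_default ?mul0rn // szf; lia.
have f1n1 : f1 n.-1 = 0.
  rewrite /f1 (_ : f^`N(n.-1) = (f`_n.-1)%:P + n%:R *: 'X).
    rewrite hornerD hornerC hornerZ hornerX /s mulrA.
    have monon k : mono 0 k%:R = k%:R :> L.
      by elim: k => [|k IHk]; rewrite ?mono00 // -addn1 !natrD monoD IHk.
    rewrite -monon monoM mulrN mulfV // addr0.
    have : mono 0 1 + mono 0 (-1) = 0 :> L by rewrite -monoD addrN mono00.
    by rewrite mono1 => e; rewrite -{1}[f`_n.-1]mul1r -mulrDl e mul0r.
  apply/polyP => i; rewrite coef_nderivn coefD coefC coefZ coefX.
  case: i => [|[|i]] /=; rewrite ?addn0 ?binn ?mulr0 ?addr0 ?mulr1 ?add0r //.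
    by rewrite addn1 binSn prednK // fn.
  by rewrite nth_default ?mul0rn // szf; lia.
have f1E z : f.[s + z] = \sum_(j < n.+1) f1 j * z ^+ j.
  by rewrite (nderiv_taylor _ (mulrC s z)) szf.
(* In this case [f] is the [n]-th power of [X - s]. *)
have [all0|] := pselect (forall j : 'I_n, f1 j = 0).
  exists s; rewrite /root -[s]addr0 f1E big_ord_recl big1 ?addr0.
    by rewrite expr0 mulr1 (all0 (Ordinal n0)).
  by move=> i _; rewrite expr0n mulr0.
move/existsNP => [i0 /eqP fi0].
have exv (j : 'I_n) : exists v, f1 j != 0 ->
    coef (f1 j) v != 0 /\ forall e, coef (f1 j) e != 0 -> v <= e.
  have [->|/exists_val[v vP]] := eqVneq (f1 j) 0; first by exists 0.
  by exists v.
have [v vP] := choice exv.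
(* Substituting [x^r t] and dividing by [x^(r n)] gives the coefficient of [t^j] the valuation
   [v j - r (n - j)]. The least [q j] is the largest [r] for which these are all nonnegative, and
   one of them is then 0. *)
pose q (j : 'I_n) := v j / (n%:R - j%:R).
have nj (j : 'I_n) : 0 < n%:R - j%:R :> rat by rewrite subr_gt0 ltr_nat.
case: (@arg_minP _ _ _ i0 (fun j => f1 j != 0) q fi0) => i1 fi1 qmin.
pose r := q i1.
pose F (j : 'I_n.+1) : L := mono (r * (j%:R - n%:R)) 1 * f1 j.
have FE (j : 'I_n.+1) e : coef (F j) e = coef (f1 j) (e - r * (j%:R - n%:R)).
  by rewrite coef_monoM mul1r.
have Fn : F ord_max = 1 by rewrite /F /= f1n mulr1 subrr mulr0.
have F0 j e : coef (F j) e != 0 -> 0 <= e.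
  have [jn|nj'] := ltnP j n.
    rewrite FE; pose k := Ordinal jn; rewrite -[nat_of_ord j]/(nat_of_ord k).
    have [->|fk] := eqVneq (f1 k) 0; first by rewrite coefp0 eqxx.
    have /= := qmin k fk; rewrite -/r {1}/q ler_pdivlMr //.
    by move=> rv /((vP k fk).2); lra.
  have -> : j = ord_max by apply/val_inj => /=; have := ltn_ord j; lia.
  by rewrite Fn coefp1; case: (e =P 0) => [->//|_]; rewrite eqxx.
have [p dF] := common_denom F.
pose P : {poly L} := \poly_(j < n.+1) F (inord j).
pose fs k := \poly_(j < n.+1) coef (F (inord j)) (k%:R / p.+1%:R).
have PE : P = pserpoly p n.+1 fs by apply: pserpoly_of_denom.
have fs0 j : (j < n.+1)%N -> (fs 0%N)`_j = coef (f1 j) (r * (n%:R - j%:R)).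
  move=> jn; rewrite coef_poly jn FE inordK //; congr (coef _ _).
  by rewrite mul0r; ring.
have fsn k : (fs k)`_n = (k == 0%N)%:R.
  rewrite coef_poly ltnSn (_ : inord n = ord_max); last first.
    by apply: val_inj; rewrite /= inordK.
  rewrite Fn coefp1 mulf_eq0 invr_eq0 !pnatr_eq0 orbF.
  by case: (k == 0%N).
have szf0 : size (fs 0%N) = n.+1.
  by rewrite size_poly_eq //; have := fsn 0%N; rewrite coef_poly ltnSn => ->;
    rewrite oner_eq0.
have f0m : fs 0%N \is monic by rewrite monicE lead_coefE szf0 fsn.
have szf' k : (0 < k)%N -> (size (fs k) <= n)%N.
  move=> k0; apply/leq_sizeP => j; rewrite leq_eqVlt => /predU1P[<-|nj'].
    by rewrite fsn eqn0Ngt k0.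
  by rewrite coef_poly ltnS leqNgt nj'.
have f0n1 : (fs 0%N)`_n.-1 = 0 by rewrite fs0 ?f1n1 // ltnS leq_pred.
(* The slope is attained at [i1 < n], so the residual polynomial is not [X^n]. *)
have f0i1 : (fs 0%N)`_i1 != 0.
  have rv : r * (n%:R - i1%:R) = v i1 by rewrite /r /q divfK // gt_eqF.
  have [vi1 _] := vP i1 fi1.
  have -> : (fs 0%N)`_i1 = coef (f1 i1) (v i1) by rewrite fs0 ?rv // leqW.
  by [].
have [c rc] : exists c, root (fs 0%N) c by apply/closed_rootP;
  rewrite szf0 eqSS -lt0n.
have [m [h]] := multiplicity_XsubC (fs 0%N) c.
rewrite monic_neq0 //= => hc fsE.
have hm : h \is monic.
  by move: f0m; rewrite fsE monicMr // monic_exp // monicXsubC.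
have m0 : (0 < m)%N.
  by rewrite lt0n; apply: contraNneq hc => m0; move: rc;
    rewrite fsE m0 expr0 mulr1.
have szE : n.+1 = (size h + m)%N.
  rewrite -szf0 fsE size_Mmonic ?monic_neq0 ?monic_exp ?monicXsubC //.
  by rewrite size_exp_XsubC addnS.
(* A root of multiplicity [n] would make the coefficient of degree [n - 1] equal to [- n c]; as it
   vanishes, [c = 0] and the residual polynomial would be [X^n]. *)
have mn : (m < n)%N.
  rewrite ltnNge; apply/negP => nm.
  have szh : (0 < size h)%N by rewrite size_poly_gt0 monic_neq0.
  have [mE szh1] : m = n /\ size h = 1%N by lia.
  have h1 : h = 1.
    move: hm; rewrite (size1_polyC (eq_leq szh1)) monicE lead_coefC => /eqP ->.
    by [].
  have fsE' : fs 0%N = \prod_(x <- nseq n c) ('X - x%:P).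
    by rewrite fsE h1 mul1r mE big_nseq iter_mulr_1.
  have c0 : c = 0.
    have := f0n1; rewrite fsE'.
    have sznc : size (nseq n c) = n by rewrite size_nseq.
    rewrite -{2}sznc coefPn_prod_XsubC ?size_nseq -?lt0n // big_nseq
      iter_addr_0.
    by move/eqP; rewrite oppr_eq0 mulrn_eq0 eqn0Ngt n0 => /eqP.
  by move: f0i1; rewrite fsE h1 mul1r mE c0 subr0 coefXn ltn_eqF ?eqxx.
have gm0 : ('X - c%:P) ^+ m \is monic by rewrite monic_exp ?monicXsubC.
have cop : coprimep (('X - c%:P) ^+ m) h.
  by rewrite coprimep_pexpl // coprimep_sym coprimep_XsubC.
rewrite mulrC in fsE.
have [g [hh [PgE gm szg]]] := hensel_factor p fsE gm0 hm cop szf0 szf'.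
have [x /eqP gx] : exists x, root g x.
  by apply: (IH m) => //; rewrite szg size_exp_XsubC.
(* Undoes translation and rescaling, by [f(s + x^r t) = x^(r n) P(t)]. *)
exists (s + mono r 1 * x).
suff -> : root f (s + mono r 1 * x) = (mono (r * n%:R) 1 * P.[x] == 0).
  by rewrite PE PgE hornerM gx mul0r mulr0.
rewrite /root f1E horner_poly mulr_sumr; congr (_ == _); apply: eq_bigr => j _.
rewrite inord_val /F !mulrA monoM mulr1 exprMn mulrA; congr (_ * _).
rewrite mulrC; congr (_ * _).
have -> : r * n%:R + r * (j%:R - n%:R) = r * j%:R by ring.
by elim: (nat_of_ord j) => [|k IHk];
  rewrite ?mulr0 // exprS IHk monoM mulr1 -natr1;
  congr mono; ring.
Qed.

Theorem puiseux_root (f : {poly L}) : f \is monic -> (1 < size f)%N ->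
  exists x, root f x.
Proof.
move=> fm szf; have szE : size f = (size f).-1.+1 by rewrite prednK // ltnW.
by apply: (puiseux_root_rec _ szE fm); rewrite -ltnS -szE.
Qed.

End NewtonPuiseux.

(** * Extending homomorphisms along a Galois extension *)

Section Nilpotent.
Variable B : comNzRingType.
Implicit Types (x y u : B) (f : {poly B}).

Definition is_nilpotent x := exists k, x ^+ k = 0.
Definition invertible x := exists y, y * x = 1.

Lemma nilp0 : is_nilpotent 0. Proof. by exists 1%N; rewrite expr1. Qed.

Lemma nilpM x y : is_nilpotent x -> is_nilpotent (y * x).
Proof. by move=> [k xk]; exists k; rewrite exprMn xk mulr0. Qed.

Lemma nilpN x : is_nilpotent x -> is_nilpotent (- x).
Proof. by rewrite -mulN1r; apply: nilpM. Qed.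

Lemma nilpD x y : is_nilpotent x -> is_nilpotent y -> is_nilpotent (x + y).
Proof.
move=> [k xk] [l yl]; exists (k + l)%N; rewrite exprDn big1 // => i _.
have [li|] := leqP l i.
  by rewrite -(subnKC li) [y ^+ _]exprD yl mul0r mulr0 mul0rn.
move=> il; have ki : (k <= k + l - i)%N by lia.
by rewrite -(subnKC ki) [x ^+ _]exprD xk !mul0r mul0rn.
Qed.

(** A finite geometric series in the nilpotent [- v x] provides the inverse. *)
Lemma invertible_nilpD u x : invertible u -> is_nilpotent x ->
  invertible (u + x).
Proof.
move=> [v vu] xn; have [k nk] := nilpM (- v) xn.
set n := - v * x in nk.
have e : 1 - n = v * (u + x) by rewrite mulrDr vu /n mulNr opprK.
exists (v * \sum_(i < k) n ^+ i); rewrite mulrAC -e.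
by have := subrX1 n k; rewrite nk sub0r -opprB mulNr => /oppr_inj <-.
Qed.

Lemma invertible_cancel u x : invertible u -> u * x = 0 -> x = 0.
Proof. by move=> [v vu] ux; rewrite -[x]mul1r -vu -mulrA ux mulr0. Qed.

Lemma taylor2 f x h : exists q, f.[x + h] = f.[x] + f^`().[x] * h + q * h ^+ 2.
Proof.
elim/poly_ind: f => [|f c [q fE]].
  by exists 0; rewrite deriv0 !horner0 !mul0r !addr0.
exists (q * (x + h) + f^`().[x]).
rewrite derivD derivM derivX derivC addr0 mulr1 !hornerD !hornerM !hornerX
  !hornerC fE.
by ring.
Qed.

(** Newton's iteration: the correction [- f(b) / f'(b)] squares the error, which halves an exponent
    of nilpotency of the form [2^n]; the derivative changes by a nilpotent and stays invertible. *)
Lemma newton_root f b : is_nilpotent f.[b] -> invertible f^`().[b] ->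
  exists2 b', f.[b'] = 0 & is_nilpotent (b' - b).
Proof.
move=> [n0 fb0]; have: f.[b] ^+ (2 ^ n0) = 0.
  by rewrite -(subnKC (ltnW (ltn_expl n0 (ltnSn 1)))) exprD fb0 mul0r.
move: (n0) => n {n0 fb0}; elim: n b => [|n IH] b fb [y yf].
  by exists b; [rewrite -[RHS]fb expr1 | rewrite subrr; apply: nilp0].
pose h := - (y * f.[b]).
have hn : is_nilpotent h by apply/nilpN/nilpM; exists (2 ^ n.+1)%N.
have [q fh] := taylor2 f b h; have [q' fh'] := taylor2 f^`() b h.
have [||b' fb' b'n] := IH (b + h).
- have -> : f.[b + h] = q * y ^+ 2 * f.[b] ^+ 2.
    by rewrite fh /h mulrN mulrA [_ * y]mulrC yf; ring.
  by rewrite exprMn -exprM -expnS fb mulr0.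
- rewrite fh' -addrA; apply: invertible_nilpD; first by exists y.
  by rewrite expr2 mulrA -mulrDl; apply: nilpM.
exists b' => //; rewrite -[b' - b](subrK h); apply: nilpD => //.
by rewrite -addrA -opprD.
Qed.

(** By Taylor expansion [f(b') - f(b)] is [b' - b] times a unit, namely [f'(b)] plus a nilpotent. *)
Lemma newton_uniq f b b' : f.[b] = 0 -> f.[b'] = 0 -> invertible f^`().[b] ->
  is_nilpotent (b' - b) -> b' = b.
Proof.
move=> fb fb' inv bn; have [q] := taylor2 f b (b' - b).
rewrite addrC subrK fb fb' add0r expr2 mulrA -mulrDl => /esym e.
apply/eqP; rewrite -subr_eq0; apply/eqP; apply: invertible_cancel e.
by apply: invertible_nilpD => //; apply: nilpM.
Qed.

End Nilpotent.

(** * The extension [K / K^G] and its morphisms to a commutative ring *)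

Section Galois.
Context (C : numClosedFieldType) (K : fieldAlgType C) (D : derivation K).
Context (G : finGroupType) (act : autGroup D G).
Local Notation F := (fixed act).

Definition fval : {rmorphism F -> K} := \val.

Lemma act_fval g (a : F) : act g (fval a) = fval a.
Proof. by have /fixed_predP := valP a; apply. Qed.

Lemma natr_neq0 n : (0 < n)%N -> n%:R != 0 :> K.
Proof.
move=> n0; rewrite -[n%:R]mulr1 mulr_natl -scaler_nat scaler_eq0 oner_eq0 orbF.
by rewrite pnatr_eq0 -lt0n.
Qed.

Lemma natr_inj : injective (fun n => n%:R : K).
Proof.
have lt m n : (m < n)%N -> m%:R != n%:R :> K.
  by move=> mn; rewrite eq_sym -subr_eq0 -natrB ?natr_neq0 ?subn_gt0 // ltnW.
by move=> m n /eqP e; case: (ltngtP m n) => // /lt; rewrite ?e // eq_sym e.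
Qed.

Lemma exists_nonroot (p : {poly K}) : p != 0 -> exists n : nat, p.[n%:R] != 0.
Proof.
move=> p0; apply: contrapT => none.
have := @max_poly_roots _ p [seq n%:R | n <- iota 0 (size p)] p0.
rewrite map_inj_uniq ?iota_uniq; last exact: natr_inj.
rewrite size_map size_iota ltnn => H; apply/notF/H => //.
apply/allP => _ /mapP[n _ ->]; apply: contraT => pn.
by case: none; exists n.
Qed.

(** Faithfulness gives a [u] moved by [g]. The element [t + n u] fails for [h] only when [n] is a
    root of the nonzero polynomial [P h], and characteristic 0 leaves a natural [n] that avoids the
    finitely many roots. *)
Lemma exists_primitive : exists theta : K, forall g, g != 1%g ->
  act g theta != theta.
Proof.
suff [t tP] : exists theta : K, forall g, g \in enum G -> g != 1%g ->
  act g theta != theta.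
  by exists t => g; apply: tP; rewrite mem_enum.
elim: (enum G) => [|g s [t tP]]; first by exists 0.
have [->|g1] := eqVneq g 1%g.
  by exists t => h; rewrite inE => /predU1P[->|/tP//]; rewrite eqxx.
have [u gu] : exists u, act g u != u.
  apply: contrapT => none; case/eqP: g1;
    apply: (@aut_faithful _ _ _ _ act g) => u.
  by apply/eqP; apply: contraT => gu; case: none; exists u.
pose P h : {poly K} := (act h t - t)%:P + (act h u - u) *: 'X.
have P0 h : h \in g :: s -> h != 1%g -> P h != 0.
  move=> hs h1; apply/eqP => /polyP Ph; have := Ph 0%N; have := Ph 1%N.
  rewrite !coefD !coefC !coefZ !coefX ?coef0 /= mulr0 mulr1 addr0 add0r.
  move=> /eqP; rewrite subr_eq0 => hu /eqP; rewrite subr_eq0 => ht.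
  move: hs; rewrite inE => /predU1P[hg|hs];
    first by rewrite hg (negPf gu) in hu.
  by have := tP _ hs h1; rewrite ht.
have [|n Pn] := @exists_nonroot (\prod_(h <- g :: s | h != 1%g) P h).
  by rewrite prodf_seq_neq0; apply/allP => h hs; apply/implyP; apply: P0.
exists (t + n%:R * u) => h hs h1; apply: contraNneq Pn => e.
rewrite horner_prod prodf_seq_eq0; apply/hasP; exists h; rewrite ?h1 //=.
rewrite /P !hornerE; apply/eqP; move: e.
rewrite rmorphD rmorphM rmorph_nat => /eqP; rewrite -subr_eq0 => /eqP <-.
by ring.
Qed.

Lemma poly_fixed (P : {poly K}) : (forall g, map_poly (act g) P = P) ->
  exists q : {poly F}, map_poly fval q = P.
Proof.
move=> Pg; have Pf i : P`_i \in fixed_pred act.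
  by apply/fixed_predP => g; rewrite -[in RHS](Pg g) coef_map.
exists (\poly_(i < size P) Fixed (Pf i)); apply/polyP => i.
rewrite coef_map coef_poly; case: ltnP => // si.
by rewrite nth_default.
Qed.

Definition theta := sval (cid exists_primitive).

Lemma act_theta g : g != 1%g -> act g theta != theta.
Proof. exact: svalP (cid exists_primitive) g. Qed.

Lemma act_theta_inj : injective (fun g => act g theta).
Proof.
move=> g h gh; apply/eqP; rewrite eq_mulVg1; apply: contraT => /act_theta.
by rewrite autM -gh -autM mulVg aut1 eqxx.
Qed.

Lemma exists_minp :
  exists f : {poly F}, map_poly fval f = \prod_(g : G) ('X - (act g theta)%:P).
Proof.
apply: poly_fixed => h; rewrite rmorph_prod /= [RHS](reindex_inj (mulgI h)) /=.
by apply: eq_bigr => g _; rewrite rmorphB /= map_polyX map_polyC /= autM.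
Qed.

Definition minp := sval (cid exists_minp).

Lemma minpE : map_poly fval minp = \prod_(g : G) ('X - (act g theta)%:P).
Proof. exact: svalP (cid exists_minp). Qed.

Lemma minp_theta : (map_poly fval minp).[theta] = 0.
Proof.
by rewrite minpE horner_prod (bigD1 1%g) //= aut1 !hornerE subrr mul0r.
Qed.

(** A polynomial over [F] that vanishes at [theta] vanishes at all its conjugates, which are
    distinct. *)
Lemma minp_dvd (P : {poly F}) : (map_poly fval P).[theta] = 0 -> minp %| P.
Proof.
move=> Pt; rewrite -(dvdp_map fval) minpE.
rewrite -(big_map (fun g => act g theta) xpredT (fun x => 'X - x%:P)).
apply: uniq_roots_dvdp.
  apply/allP => _ /mapP[g _ ->]; rewrite /root.
  have -> : map_poly fval P = map_poly (act g) (map_poly fval P).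
    apply/polyP => i; rewrite !coef_map /=.
    by rewrite -[RHS]/(act g (fval P`_i)) act_fval.
  by rewrite horner_map Pt rmorph0.
rewrite uniq_rootsE map_inj_uniq; last exact: act_theta_inj.
by rewrite /index_enum; case: index_enum_key; rewrite /= -enumT enum_uniq.
Qed.

Lemma minp_deriv : (map_poly fval minp)^`().[theta] != 0.
Proof.
rewrite minpE (bigD1 1%g) //= aut1 derivM derivXsubC mul1r hornerD hornerM.
rewrite hornerXsubC subrr mul0r addr0 horner_prod; apply/prodf_neq0 => g g1.
by rewrite hornerXsubC subr_eq0 eq_sym act_theta.
Qed.

(* Lagrange interpolation at the conjugates of [theta]: the interpolating
   polynomial is invariant under [G]. *)
Lemma gen_theta c : exists P : {poly F}, (map_poly fval P).[theta] = c.
Proof.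
pose lag g : {poly K} := \prod_(h | h != g) ('X - (act h theta)%:P).
have lagE h g : map_poly (act h) (lag g) = lag (h * g)%g.
  rewrite /lag rmorph_prod /= [RHS](reindex_inj (mulgI h)) /=.
  apply: eq_big => [k|k _]; first by rewrite (inj_eq (mulgI h)).
  by rewrite rmorphB /= map_polyX map_polyC /= autM.
have lag0 g : (lag g).[act g theta] != 0.
  rewrite horner_prod; apply/prodf_neq0 => h hg.
  by rewrite hornerXsubC subr_eq0 eq_sym (inj_eq act_theta_inj).
pose P := \sum_g (act g c / (lag g).[act g theta]) *: lag g.
have [|Q QP] := @poly_fixed P.
  move=> h; rewrite /P rmorph_sum /= [RHS](reindex_inj (mulgI h)) /=.
  apply: eq_bigr => g _; rewrite map_polyZ lagE; congr (_ *: _).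
  by rewrite rmorphM fmorphV -horner_map /= lagE !autM.
exists Q; rewrite QP /P horner_sum (bigD1 1%g) //= big1 ?addr0.
  have := lag0 1%g; rewrite !aut1 => l0.
  by rewrite hornerZ divfK.
move=> g g1; rewrite hornerZ (_ : (lag g).[theta] = 0) ?mulr0 //.
rewrite horner_prod (bigD1 1%g) ?(eq_sym 1%g) //=.
by rewrite aut1 hornerXsubC subrr mul0r.
Qed.

Section Extension.
Variables (B : comNzRingType).
Implicit Types (y : {rmorphism F -> B}) (z : {rmorphism K -> B}).

Lemma horner_ext y z P : (forall a, z (fval a) = y a) ->
  z (map_poly fval P).[theta] = (map_poly y P).[z theta].
Proof.
move=> zy; rewrite -horner_map; congr (_.[_]); apply/polyP => i.
by rewrite !coef_map /= -zy.
Qed.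

Lemma ext_eq z1 z2 : (forall a, z1 (fval a) = z2 (fval a)) ->
  z1 theta = z2 theta -> z1 =1 z2.
Proof.
move=> e et c; have [P <-] := gen_theta c.
rewrite (@horner_ext (z1 \o fval) z1) // (@horner_ext (z1 \o fval) z2) ?et //.
by move=> a; rewrite /= e.
Qed.

Lemma minp_ext y z : (forall a, z (fval a) = y a) ->
  (map_poly y minp).[z theta] = 0.
Proof. by move=> zy; rewrite -horner_ext // minp_theta rmorph0. Qed.

(** Separability makes the derivative at [theta] a unit of the field [K], and morphisms preserve
    units; this holds in [B] even with nilpotents. *)
Lemma minp_deriv_ext y z : (forall a, z (fval a) = y a) ->
  invertible (map_poly y minp)^`().[z theta].
Proof.
move=> zy; rewrite deriv_map -horner_ext //; set d := (_).[_].
have d0 : d != 0 by rewrite /d -deriv_map minp_deriv.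
by exists (z d^-1); rewrite -rmorphM mulVf // rmorph1.
Qed.

(** Since [K] is [F[X] / (minp)], a chosen polynomial expression in [theta] is evaluated at [t]; by
    [minp_dvd] the value is independent of the choice. *)
Lemma exists_ext y t : (map_poly y minp).[t] = 0 ->
  exists z : {rmorphism K -> B}, (forall a, z (fval a) = y a) /\ z theta = t.
Proof.
move=> yt; have key P : (map_poly fval P).[theta] = 0 -> (map_poly y P).[t] = 0.
  by move=> /minp_dvd/divpK <-; rewrite rmorphM hornerM yt mulr0.
have keyE P Q : (map_poly fval P).[theta] = (map_poly fval Q).[theta] ->
    (map_poly y P).[t] = (map_poly y Q).[t].
  move=> /eqP; rewrite -subr_eq0 -hornerN -hornerD -rmorphB => /eqP/key/eqP.
  by rewrite rmorphB hornerD hornerN subr_eq0 => /eqP.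
have [q qE] := choice gen_theta.
pose z c := (map_poly y (q c)).[t].
have zB : zmod_morphism z.
  move=> a b; rewrite /z -hornerN -hornerD -rmorphB; apply: keyE.
  by rewrite rmorphB hornerD hornerN !qE.
have zM : monoid_morphism z.
  split=> [|a b].
    by rewrite /z (@keyE _ 1) ?rmorph1 ?hornerC // qE.
  rewrite /z -hornerM -rmorphM; apply: keyE.
  by rewrite rmorphM hornerM !qE.
pose zBm := GRing.isZmodMorphism.Build K B z zB.
pose zMm := GRing.isMonoidMorphism.Build K B z zM.
pose zz : {rmorphism K -> B} := HB.pack z zBm zMm.
exists zz; split=> [a|] /=.
  by rewrite /z (@keyE _ a%:P) ?map_polyC ?hornerC.
by rewrite /z (@keyE _ 'X) ?qE ?map_polyX ?hornerX.
Qed.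

(** The images of [theta] are roots of [minp] with invertible derivative, and such roots are
    isolated modulo nilpotents. *)
Lemma ext_uniq z1 z2 : (forall a, z1 (fval a) = z2 (fval a)) ->
  is_nilpotent (z2 theta - z1 theta) -> z1 =1 z2.
Proof.
move=> e n; apply: ext_eq => //; apply/esym.
pose y : {rmorphism F -> B} := z1 \o fval.
apply: (@newton_uniq _ (map_poly y minp)) => //.
- exact: minp_ext.
- by apply: minp_ext => a; rewrite /= -e.
exact: minp_deriv_ext.
Qed.

(** Over a domain, a root of the image of [minp] is a root of one of its linear factors, which come
    from the conjugates of [theta]. *)
Lemma ext_conj z1 z2 : (forall u v : B, u * v = 0 -> u = 0 \/ v = 0) ->
  (forall a, z1 (fval a) = z2 (fval a)) -> exists g, z2 =1 z1 \o act g.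
Proof.
move=> dom e; pose y : {rmorphism F -> B} := z1 \o fval.
have := @minp_ext y z2 (fun a => esym (e a)).
have -> : map_poly y minp = map_poly z1 (map_poly fval minp).
  by rewrite -map_poly_comp; apply/polyP => i; rewrite !coef_map.
rewrite minpE rmorph_prod horner_prod => prod0.
have [g /eqP gE] : exists g, z2 theta - z1 (act g theta) == 0.
  apply: contrapT => none.
  suff : \prod_g (map_poly z1 ('X - (act g theta)%:P)).[z2 theta] != 0.
    by rewrite prod0 eqxx.
  apply: (big_ind (fun x => x != 0)); first exact: oner_neq0.
    by move=> u v /eqP u0 /eqP v0; apply/eqP => /dom[].
  move=> g _; rewrite rmorphB /= map_polyX map_polyC hornerXsubC.
  by apply/negP => gz; apply: none; exists g.
exists g; apply: (@ext_eq z2 (z1 \o act g)) => [a|] /=.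
  by rewrite act_fval e.
by apply/eqP; rewrite -subr_eq0 gE.
Qed.

(** From [d (P(theta)) = P'(theta) d theta], applied to [minp], one gets [d theta = 0]. *)
Lemma der_ext_eq0 z (d : K -> B) : zmod_morphism d ->
  (forall a b, d (a * b) = z a * d b + d a * z b) ->
  (forall a, d (fval a) = 0) -> d =1 fun=> 0.
Proof.
move=> dB dM dF.
have d0 : d 0 = 0 by rewrite -[0](subrr 0) dB subrr.
have dD a b : d (a + b) = d a + d b.
  have dN c : d (- c) = - d c by rewrite -[- c]sub0r dB d0 sub0r.
  by rewrite -{1}[b]opprK dB dN opprK.
have dP P : d (map_poly fval P).[theta] = z (map_poly fval P)^`().[theta] * d
  theta.
  elim/poly_ind: P => [|P c IH].
    by rewrite rmorph0 deriv0 !horner0 d0 rmorph0 mul0r.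
  have -> : map_poly fval (P * 'X + c%:P) = map_poly fval P * 'X + (fval c)%:P.
    rewrite rmorphD rmorphM; congr (_ * _ + _); first exact: map_polyX.
    exact: map_polyC.
  rewrite derivD derivM derivX derivC.
  rewrite addr0 mulr1 !hornerD !hornerM !hornerX hornerC dD dF addr0 dM IH.
  by rewrite rmorphD rmorphM; ring.
have dt : d theta = 0.
  have := dP minp; rewrite minp_theta d0 => /esym; apply: invertible_cancel.
  exists (z ((map_poly fval minp)^`().[theta])^-1).
  by rewrite -rmorphM mulVf ?minp_deriv // rmorph1.
by move=> c; have [P <-] := gen_theta c; rewrite dP dt mulr0.
Qed.

End Extension.

(* Newton's method lifts the root [p theta] of [minp] through the nilpotent kernel
   of [pi]. *)
Lemma ext_lift (B L : comNzRingType) (pi : {rmorphism B -> L})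
    (y : {rmorphism F -> B}) (p : {rmorphism K -> L}) :
  (forall u : L, is_nilpotent u -> u = 0) -> (forall b, pi b = 0 ->
    is_nilpotent b) ->
  (forall u, exists b, pi b = u) ->
  (forall a, p (fval a) = pi (y a)) ->
  exists z : {rmorphism K -> B}, (forall a, z (fval a) = y a) /\ pi \o z =1 p.
Proof.
move=> red kn sur py; have [b0 b0E] := sur (p theta).
have pim P : pi (map_poly y P).[b0] = p (map_poly fval P).[theta].
  rewrite -!horner_map b0E; congr (_.[_]).
  by apply/polyP => i; rewrite !coef_map /= py.
have [||t yt tn] := @newton_root _ (map_poly y minp) b0.
- by apply: kn; rewrite pim minp_theta rmorph0.
(* The derivative at [b0] is a unit because it is one modulo the nilpotent kernel. *)
- have [b bE] := sur (p ((map_poly fval minp)^`().[theta])^-1).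
  have /kn n1 : pi (b * (map_poly y minp)^`().[b0] - 1) = 0.
    rewrite rmorphB rmorphM rmorph1 deriv_map pim -deriv_map bE -rmorphM.
    by rewrite mulVf ?minp_deriv // rmorph1 subrr.
  have i1 : invertible (1 : B) by exists 1; rewrite mul1r.
  have [v vE] := invertible_nilpD i1 n1.
  by exists (v * b); rewrite -vE -mulrA addrCA subrr addr0.
have [z [zy zt]] := exists_ext yt.
exists z; split=> //; apply: (@ext_eq L (pi \o z)) => [a|].
  by rewrite [RHS]py -zy.
(* The root [t] differs from [b0] by a nilpotent, whose image in the reduced ring [L] is 0. *)
rewrite /= zt -b0E; apply/eqP; rewrite -subr_eq0 -rmorphB; apply/eqP/red.
by have [k tk] := tn; exists k; rewrite -rmorphXn tk rmorph0.
Qed.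

End Galois.

(** * Commutative algebras of endomorphisms *)

Section Endo.
Import passmx.
Context (C : numClosedFieldType) (M : vectType C).
Implicit Types (X N : 'End(M)).

Lemma exists_eigenvector X : (fullv : {vspace M}) != 0%VS ->
  exists (c : C) v, v != 0 /\ X v = c *: v.
Proof.
move=> M0; pose e := vbasis (fullv : {vspace M}).
have eb : basis_of fullv e := vbasisP _.
have [c rc] : exists c, root (char_poly (mxof e e X)) c.
  by apply/closed_rootP; rewrite size_char_poly eqSS dimv_eq0.
move: rc; rewrite -eigenvalue_root_char => /eigenvalueP[v vE v0].
exists c, (vecof e v); split; first by rewrite vecof_eq0 ?(basis_free eb).
by rewrite (hom_vecof e eb) vE linearZ.
Qed.

Definition lexp N k : 'End(M) := iter k (comp_lfun N) \1%VF.

Lemma lexpS N k : lexp N k.+1 = (N \o lexp N k)%VF. Proof. by []. Qed.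

Lemma lexpD N k l v : lexp N (k + l) v = lexp N k (lexp N l v).
Proof.
by elim: k => [|k IH]; rewrite ?id_lfunE // addSn !lexpS !comp_lfunE IH.
Qed.

Lemma lexp_comm N X k v : (forall u, X (N u) = N (X u)) ->
  X (lexp N k v) = lexp N k (X v).
Proof.
by move=> XN; elim: k => [|k IH]; rewrite ?id_lfunE // !lexpS !comp_lfunE XN IH.
Qed.

(** At a positive power of least rank, the power is injective on its own image. Positivity of the
    exponent puts the kernel of [N] inside the kernel of the power. *)
Lemma fitting N : exists k, (lker (lexp N k.+1) :&: limg (lexp N k.+1) = 0)%VS
  /\ (lker (lexp N k.+1) + limg (lexp N k.+1) = fullv)%VS.
Proof.
have exd : exists d, `[< exists k, \dim (limg (lexp N k.+1)) = d >].
  by exists (\dim (limg (lexp N 1))); apply/asboolP; exists 0%N.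
case: (ex_minnP exd) => d /asboolP[k kd] dmin; exists k.
have cap0 : (lker (lexp N k.+1) :&: limg (lexp N k.+1) = 0)%VS.
  apply/eqP; rewrite -dimv_eq0 capvC.
  have := limg_ker_dim (lexp N k.+1) (limg (lexp N k.+1)); rewrite -limg_comp.
  have -> : (lexp N k.+1 \o lexp N k.+1)%VF = lexp N (k.+1 + k.+1).
    by apply/lfunP => v; rewrite comp_lfunE lexpD.
  have : (d <= \dim (limg (lexp N (k.+1 + k.+1))))%N.
    by apply: dmin; apply/asboolP; exists (k + k.+1)%N.
  by rewrite kd; lia.
split=> //; apply/eqP; rewrite eqEdim subvf dimv_disjoint_sum //.
by have := limg_ker_dim (lexp N k.+1) fullv; rewrite capfv => ->; rewrite leqnn.
Qed.

(* The generalized eigenspaces of [X] are submodules. *)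
Lemma indecomposable_nilp (A : comAlgType C) (Y : A -> rat -> 'End(M)) X :
  (fullv : {vspace M}) != 0%VS -> indecomposable Y ->
  (forall a e, (X \o Y a e)%VF = (Y a e \o X)%VF) ->
  exists (c : C) k, forall v, lexp (X - c *: \1%VF) k v = 0.
Proof.
move=> M0 ind comm; have [c [v [v0 Xv]]] := exists_eigenvector X M0.
exists c; set N := X - _; have [k [cap0 addf]] := fitting N.
have Nc a e u : Y a e (N u) = N (Y a e u).
  have /lfunP/(_ u) := comm a e; rewrite !comp_lfunE => XY.
  by rewrite !add_lfunE !opp_lfunE !scale_lfunE !id_lfunE linearB linearZ XY.
(* The kernel summand contains the eigenvector [v], so it is the image that vanishes. *)
exists k.+1; have [||k0|i0] := ind _ _ _ _ addf cap0.
- move=> a e; apply/subvP => _ /memv_imgP[u uk ->]; move: uk.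
  by rewrite !memv_ker -lexp_comm // => /eqP ->; rewrite linear0.
- move=> a e; apply/subvP => _ /memv_imgP[_ /memv_imgP[u _ ->] ->].
  by rewrite lexp_comm // memv_img ?memvf.
- case/eqP: v0; apply/eqP; rewrite -memv0 -k0 memv_ker.
  have Nv : N v = 0 by rewrite add_lfunE opp_lfunE scale_lfunE id_lfunE Xv
    subrr.
  by rewrite -addn1 lexpD lexpS comp_lfunE id_lfunE Nv linear0.
by move=> u; apply/eqP; rewrite -memv0 -i0 memv_img ?memvf.
Qed.

End Endo.

(** Nontriviality of [M] is bundled so that [1 != 0] in the ring [celt] of elements. *)
Record commalg (C : fieldType) (M : vectType C) := CommAlg {
  ca_set :> set 'End(M);
  ca_subalgebra : subalgebra ca_set;
  ca_comm : forall X Y, ca_set X -> ca_set Y -> (X \o Y)%VF = (Y \o X)%VF;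
  ca_nontrivial : (fullv : {vspace M}) != 0%VS
}.

Section CommAlgRing.
Context (C : fieldType) (M : vectType C) (S : commalg M).
Definition ca_pred : {pred 'End(M)} := fun X => `[< ca_set S X >].

Lemma ca_zero : ca_set S 0.
Proof.
have := sa_lin (ca_subalgebra S) (-1) (sa_one (ca_subalgebra S))
  (sa_one (ca_subalgebra S)).
by rewrite scaleN1r addNr.
Qed.

Fact ca_zmod : zmod_closed ca_pred.
Proof.
split=> [|X Y /asboolP SX /asboolP SY]; apply/asboolP; first exact: ca_zero.
by rewrite addrC -scaleN1r; apply: sa_lin (ca_subalgebra S) _ _ _ _ _.
Qed.

HB.instance Definition _ := GRing.isZmodClosed.Build 'End(M) ca_pred ca_zmod.

Record celt := Celt {cval : 'End(M); _ : cval \in ca_pred}.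

HB.instance Definition _ := [isSub for cval].
HB.instance Definition _ := [Choice of celt by <:].
HB.instance Definition _ := [SubChoice_isSubZmodule of celt by <:].

Lemma celtP (x : celt) : ca_set S (cval x).
Proof. by apply/asboolP; case: x. Qed.

Definition celt_of X (SX : ca_set S X) : celt := @Celt X (asboolT SX).

Definition cmul (x y : celt) : celt :=
  celt_of (sa_mul (ca_subalgebra S) (celtP x) (celtP y)).
Definition cone : celt := celt_of (sa_one (ca_subalgebra S)).

Fact cmulA : associative cmul.
Proof. by move=> x y z; apply: val_inj; rewrite /= comp_lfunA. Qed.

Fact cmulC : commutative cmul.
Proof. by move=> x y; apply: val_inj; apply: ca_comm; apply: celtP. Qed.

Fact cmul1 : left_id cone cmul.
Proof. by move=> x; apply: val_inj; rewrite /= comp_lfun1l. Qed.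

Fact cmulDl : left_distributive cmul +%R.
Proof. by move=> x y z; apply: val_inj; rewrite /= comp_lfunDl. Qed.

Fact cone_neq0 : cone != 0.
Proof.
apply/eqP => /(congr1 cval) /= /lfunP e; have := ca_nontrivial S.
rewrite -subv0 => /subvPn[v _]; rewrite memv0.
by have := e v; rewrite id_lfunE zero_lfunE => ->; rewrite eqxx.
Qed.

HB.instance Definition _ := GRing.Zmodule_isComNzRing.Build celt
  cmulA cmulC cmul1 cmulDl cone_neq0.

Lemma cvalB x y : cval (x - y) = cval x - cval y. Proof. by []. Qed.
Lemma cval0 : cval 0 = 0. Proof. by []. Qed.
Lemma cvalM x y : cval (x * y) = (cval x \o cval y)%VF. Proof. by []. Qed.

Lemma cval_sum (I : Type) (r : seq I) (F : I -> celt) :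
  cval (\sum_(i <- r) F i) = \sum_(i <- r) cval (F i).
Proof. by elim/big_rec2: _ => //= i x y _ <-. Qed.

Lemma cconst_subproof (c : C) : ca_set S (c *: \1%VF).
Proof.
rewrite -[_ *: _]addr0; apply: sa_lin (ca_subalgebra S) _ _ _ _ ca_zero.
exact: sa_one (ca_subalgebra S).
Qed.

Definition cconst c : celt := celt_of (cconst_subproof c).

Fact cconst_zmod : zmod_morphism cconst.
Proof. by move=> c d; apply: val_inj; rewrite /= scalerBl. Qed.

Fact cconst_monoid : monoid_morphism cconst.
Proof.
split=> [|c d]; apply: val_inj; rewrite /= ?scale1r //.
by rewrite -comp_lfunZl comp_lfun1l scalerA.
Qed.

HB.instance Definition _ := GRing.isZmodMorphism.Build C celt cconst
  cconst_zmod.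
HB.instance Definition _ := GRing.isMonoidMorphism.Build C celt cconst
  cconst_monoid.

End CommAlgRing.

Section CommAlgNilp.
Context (C : numClosedFieldType) (M : vectType C) (S : commalg M).
Implicit Types x y : celt S.

Lemma cvalX x k : cval (x ^+ k) = lexp (cval x) k.
Proof. by elim: k => [|k IH] //; rewrite exprS cvalM IH. Qed.

Lemma nilp_lexp x : is_nilpotent x <-> exists k, forall v,
  lexp (cval x) k v = 0.
Proof.
split=> -[k xk]; exists k.
  by move=> v; rewrite -cvalX xk cval0 zero_lfunE.
by apply: val_inj; rewrite /= cvalX; apply/lfunP => v; rewrite xk zero_lfunE.
Qed.

(* Each nilpotent factor strictly lowers the rank. *)
Lemma prod_nilp_dim (s : seq (celt S)) : (forall x, x \in s ->
  is_nilpotent x) ->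
  \prod_(x <- s) x != 0 ->
  (\dim (limg (cval (\prod_(x <- s) x)%R)) + size s <= \dim (fullv :
    {vspace M}))%N.
Proof.
elim: s => [|x s IH] sn; first by rewrite addn0 dimvS ?subvf.
rewrite big_cons; set P := \prod_(y <- s) y => xP.
have P0 : P != 0 by apply: contraNneq xP => ->; rewrite mulr0.
have := IH (fun y ys => sn y (mem_behead (s := x :: s) ys)) P0; rewrite -/P.
set W := limg (cval P).
have xW : limg (cval (x * P)) = (cval x @: W)%VS by rewrite cvalM limg_comp.
have sub : (cval x @: W <= W)%VS.
  by rewrite -xW mulrC cvalM limg_comp limgS ?subvf.
suff lt : (\dim (cval x @: W) < \dim W)%N by rewrite xW /= addnS; lia.
(* With equal dimensions [x] would map [W] onto itself, and so would its powers, one of which is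
   0. *)
rewrite ltn_neqAle dimvS // andbT; apply: contraNneq xP => dE.
have WE : (cval x @: W = W)%VS by apply/eqP; rewrite eqEdim sub dE /=.
have iterW k : (lexp (cval x) k @: W = W)%VS.
  by elim: k => [|k IHk]; rewrite ?lim1g // lexpS limg_comp IHk.
have [k xk] := (nilp_lexp x).1 (sn x (mem_head _ _)).
have W0 : W = 0%VS.
  rewrite -(iterW k); apply/eqP; rewrite -lkerE; apply/subvP => v _.
  by rewrite memv_ker xk.
apply/eqP/val_inj => /=; apply/lfunP => v; apply/eqP.
by rewrite zero_lfunE -memv0 -(limg0 (cval x)) -W0 comp_lfunE !memv_img ?memvf.
Qed.

Lemma prod_nilp0 (s : seq (celt S)) : (forall x, x \in s -> is_nilpotent x) ->
  size s = \dim (fullv : {vspace M}) -> \prod_(x <- s) x = 0.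
Proof.
move=> sn sz; apply/eqP; apply: contraT => P0.
have := prod_nilp_dim sn P0; rewrite sz -[leqRHS]add0n leq_add2r leqn0 dimv_eq0.
move=> /eqP i0; case/eqP: P0; apply: val_inj; apply/lfunP => v; apply/eqP.
by rewrite zero_lfunE -memv0 -i0 memv_img ?memvf.
Qed.

End CommAlgNilp.

(** * Residues of a local algebra and of the Puiseux series over it *)

Section Residue.
Context (C : fieldType) (A : comNzRingType) (i : {rmorphism C -> A}).
Hypothesis loc : forall x : A, exists c, is_nilpotent (x - i c).

Lemma nilpotent_const c : is_nilpotent (i c) -> c = 0.
Proof.
move=> [k]; rewrite -rmorphXn => /eqP ick; apply/eqP; apply: contraTT ick => c0.
apply/eqP => ick; have := rmorph1 i;
  rewrite -(mulVf (expf_neq0 k c0)) rmorphM ick.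
by rewrite mulr0 => /esym/eqP; rewrite oner_eq0.
Qed.

(** Only the constant 0 is nilpotent, so the constant congruent to [x] is unique; uniqueness makes
    the choice additive and multiplicative. *)
Lemma exists_residue : exists l : {rmorphism A -> C},
  forall x, is_nilpotent (x - i (l x)).
Proof.
have [l lP] := choice loc.
have luniq x c : is_nilpotent (x - i c) -> l x = c.
  move=> xc; apply/eqP; rewrite eq_sym -subr_eq0; apply/eqP/nilpotent_const.
  have -> : i (c - l x) = (x - i (l x)) - (x - i c) by rewrite rmorphB; ring.
  by apply: nilpD => //; apply: nilpN.
have lB : zmod_morphism l.
  move=> x y; apply: luniq; rewrite rmorphB.
  have -> : x - y - (i (l x) - i (l y)) = (x - i (l x)) - (y - i (l y)) by ring.
  by apply: nilpD => //; apply: nilpN.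
have lM : monoid_morphism l.
  split=> [|x y]; apply: luniq; first by rewrite rmorph1 subrr; apply: nilp0.
  rewrite rmorphM.
  have -> : x * y - i (l x) * i (l y) = x * (y - i (l y)) + i (l y)
    * (x - i (l x)).
    by ring.
  by apply: nilpD; apply: nilpM.
pose lBm := GRing.isZmodMorphism.Build A C l lB.
pose lMm := GRing.isMonoidMorphism.Build A C l lM.
pose ll : {rmorphism A -> C} := HB.pack l lBm lMm.
by exists ll.
Qed.

Lemma residue_const (l : {rmorphism A ->
  C}) c : (forall x, is_nilpotent (x - i (l x))) ->
  l (i c) = c.
Proof.
move=> lP; apply/eqP; rewrite eq_sym -subr_eq0; apply/eqP/nilpotent_const.
by rewrite rmorphB.
Qed.

Lemma residue_eq0 (l : {rmorphism A ->
  C}) x : (forall x, is_nilpotent (x - i (l x))) ->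
  l x = 0 -> is_nilpotent x.
Proof. by move=> lP lx; have := lP x; rewrite lx rmorph0 subr0. Qed.

End Residue.

Section PMap.
Context (A A' : comNzRingType) (f : {rmorphism A -> A'}).

Fact puiseux_map_subproof (u : puiseux A) :
  (fun e => f (coef u e)) \in [pred f : rat -> A' | `[< pfun f >]].
Proof.
apply/asboolP; have [p [N [p0 gu]]] := coefP u; exists p, N; split=> // e fe.
by apply: gu; apply: contraNneq fe => ->; rewrite rmorph0.
Qed.

Definition puiseux_map u := Puiseux (puiseux_map_subproof u).

Lemma coef_puiseux_map u e : coef (puiseux_map u) e = f (coef u e). Proof.
  by []. Qed.

Fact puiseux_map_zmod : zmod_morphism puiseux_map.
Proof. by move=> u v; apply: coef_inj => e;
  rewrite coefpB !coef_puiseux_map coefpB rmorphB. Qed.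

Fact puiseux_map_monoid : monoid_morphism puiseux_map.
Proof.
split=> [|u v]; apply: coef_inj => e.
  by rewrite coef_puiseux_map !coefp1; case: ifP; rewrite ?rmorph1 ?rmorph0.
have [p [N [p0 gu gv]]] := grid_common (coefP u) (coefP v).
have gmap w : grid p N (coef w) -> grid p N (coef (puiseux_map w)).
  by move=> gw d fd; apply: gw; apply: contraNneq fd => wd;
    rewrite coef_puiseux_map wd rmorph0.
rewrite coef_puiseux_map !coefpM (grid_ser p0 gu) (grid_ser p0 gv).
rewrite (grid_ser p0 (gmap _ gu)) (grid_ser p0 (gmap _ gv)) !pconv_ser // /ser.
case: ifP; rewrite ?rmorph0 // => _; rewrite /sconv rmorph_sum.
by apply: eq_bigr => j _; rewrite rmorphM.
Qed.

HB.instance Definition _ := GRing.isZmodMorphism.Build (puiseux A) (puiseux A')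
  puiseux_map puiseux_map_zmod.
HB.instance Definition _ := GRing.isMonoidMorphism.Build (puiseux A)
  (puiseux A')
  puiseux_map puiseux_map_monoid.

End PMap.

Section PuiseuxNilp.
Variable A : comNzRingType.

(** Nilpotency of infinitely many coefficients has to be made uniform: each coefficient of the
    [n]-th power is a sum of products of [n] nilpotents. *)
Lemma puiseux_nilp (n : nat) (u : puiseux A) :
  (forall s : seq A, (forall x, x \in s -> is_nilpotent x) -> size s = n ->
     \prod_(x <- s) x = 0) ->
  (forall e, is_nilpotent (coef u e)) -> is_nilpotent u.
Proof.
move=> Hn un.
(* [Q k x]: [x] behaves as a product of [k] nilpotent elements. *)
pose Q k x := forall s : seq A, (forall x, x \in s -> is_nilpotent x) ->
  (size s + k)%N = n -> x * \prod_(y <- s) y = 0.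
have QS k e : Q k (coef (u ^+ k) e).
  elim: k e => [|k IH] e s sn sz.
    by rewrite (Hn s) ?mulr0 // -sz addn0.
  rewrite exprS coefpM /pconv mulr_suml big1 // => d _.
  rewrite [coef u d * _]mulrC -mulrA.
  have -> : coef u d * \prod_(y <- s) y = \prod_(y <- coef u d :: s) y.
    by rewrite big_cons.
  apply: IH => [x|].
    by rewrite inE => /predU1P[->|/sn].
  by rewrite -sz /= addSnnS.
exists n; apply: coef_inj => e; rewrite coefp0.
by have := QS n e [::]; rewrite big_nil mulr1; apply.
Qed.

End PuiseuxNilp.

Section PuiseuxDomain.
Variable A : idomainType.

(** The lowest terms multiply to a nonzero term at the sum of the valuations. *)
Lemma puiseux_domain (u v : puiseux A) : u * v = 0 -> u = 0 \/ v = 0.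
Proof.
move=> uv; have [->|u0] := eqVneq u 0; first by left.
have [->|v0] := eqVneq v 0; first by right.
have [a [ua amin]] := exists_val u0; have [b [vb bmin]] := exists_val v0.
have : coef (u * v) (a + b) = coef u a * coef v b.
  have bE : a + b - a = b by rewrite addrAC subrr add0r.
  rewrite coefpM /pconv (@finsum_seq _ _ [:: a]) //;
    first by rewrite big_seq1 bE.
  move=> d; rewrite mulf_eq0 negb_or inE => /andP[/amin ad /bmin abd].
  by rewrite eq_le ad andbT; lra.
by rewrite uv coefp0 => /esym/eqP; rewrite mulf_eq0 (negPf ua) (negPf vb).
Qed.

Lemma puiseux_reduced (u : puiseux A) : is_nilpotent u -> u = 0.
Proof.
move=> [k]; elim: k => [|k IH].
  by rewrite expr0 => /eqP; rewrite oner_eq0.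
by rewrite exprS => /puiseux_domain[].
Qed.

End PuiseuxDomain.

Section PSum.
Variable A : comNzRingType.

(** Stated for the factors and not for their products, so that one list supports every sum built
    from the same two series. *)
Lemma pconv_finite_support (f g : rat -> A) e : pfun f -> pfun g ->
  exists r : seq rat, uniq r /\ forall d, f d != 0 -> g (e - d) != 0 -> d \in r.
Proof.
move=> pf pg; have [p [N [p0 gf gg]]] := grid_common pf pg.
have p0' : 0 < p%:R :> rat by rewrite ltr0n.
pose q (k : nat) : rat := (k%:R - N%:R) / p%:R.
(* The indices of the two factors add up to [e p + 2 N]. *)
pose B := Num.truncn `|e * p%:R + N%:R + N%:R|.
exists (undup [seq q k | k <- iota 0 B.+1]); split; first exact: undup_uniq.
move=> d /gf[k ->] /gg[j]; rewrite mem_undup => eE; apply/mapP; exists k => //.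
rewrite mem_iota add0n /= ltnS /B truncn_ge_nat ?normr_ge0 //.
apply: le_trans (ler_norm _).
move: eE => /(congr1 (fun x => x * p%:R));
  rewrite mulrBl !divfK ?gt_eqF // => eE.
have := ler0n rat j; lra.
Qed.

End PSum.

(** * The Jacobi identity for commuting series *)

Section Binomial.
Variable C : fieldType.
Hypothesis natS_neq0 : forall n, n.+1%:R != 0 :> C.
Implicit Types a b : C.

Definition fbinom a i : C := (\prod_(k < i) (a - k%:R)) / (i`!)%:R.

Lemma fbinom0 a : fbinom a 0 = 1.
Proof. by rewrite /fbinom big_ord0 divr1. Qed.

Lemma fbinomS a i : i.+1%:R * fbinom a i.+1 = (a - i%:R) * fbinom a i.
Proof.
rewrite /fbinom big_ord_recr /= factS natrM.
have f0 : i`!%:R != 0 :> C by rewrite -(prednK (fact_gt0 i)).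
have i0 := natS_neq0 i.
by field; rewrite f0 addrC natr1.
Qed.

Lemma fbinom1 a : fbinom a 1 = a.
Proof. by have := fbinomS a 0; rewrite fbinom0 mul1r mulr1 subr0. Qed.

Lemma fbinom_nat n i : fbinom n%:R i = 'C(n, i)%:R.
Proof.
elim: i => [|i IH]; first by rewrite fbinom0 bin0.
apply: (mulfI (natS_neq0 i)); rewrite fbinomS IH -[RHS]natrM mul_bin_left natrM.
case: (leqP i n) => [le|lt]; first by rewrite natrB.
by rewrite bin_small ?mulr0.
Qed.

Lemma fbinom_neg k i : fbinom (- k%:R - 1) i = (-1) ^+ i * 'C(k + i, i)%:R.
Proof.
elim: i => [|i IH]; first by rewrite fbinom0 bin0 mul1r.
apply: (mulfI (natS_neq0 i)); rewrite fbinomS IH.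
rewrite [RHS]mulrCA -[X in _ = _ * X]natrM addnS -mul_bin_diag natrM exprS /=
  -natr1 natrD.
by ring.
Qed.

(** Induction on [k]: the factor [k + 1] is split as [i + (k + 1 - i)], and the recursion [fbinomS]
    is applied to one binomial in each part. *)
Lemma vandermonde a b k :
  \sum_(i < k.+1) fbinom a i * fbinom b (k - i) = fbinom (a + b) k.
Proof.
elim: k => [|k IH]; first by rewrite big_ord_recl big_ord0 addr0 !fbinom0 mul1r.
apply: (mulfI (natS_neq0 k)); rewrite fbinomS -IH !mulr_sumr.
pose F i := fbinom a i * fbinom b (k.+1 - i).
transitivity (\sum_(i < k.+2) (i%:R * F i) + \sum_(i < k.+2)
  ((k.+1 - i)%:R * F i)).
  rewrite -big_split /=; apply: eq_bigr => i _;
    rewrite -mulrDl -natrD subnKC //.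
  by rewrite -ltnS.
rewrite big_ord_recl mul0r add0r [X in _ + X]big_ord_recr /= subnn mul0r addr0.
rewrite -big_split /=; apply: eq_bigr => i _; rewrite /F /bump /= add1n subSS.
have ik : (i <= k)%N by rewrite -ltnS.
rewrite mulrA fbinomS subSn // [X in _ + X]mulrCA fbinomS natrB //.
by ring.
Qed.

End Binomial.

(** The window [-B <= t < B], listed along the two constructors of [int]; sums of finite support
    over [int] are taken over a large window. *)
Definition zseq B : seq int := [seq i%:Z | i <- iota 0 B] ++ [seq Negz i | i <-
  iota 0 B].

Lemma zseq_uniq B : uniq (zseq B).
Proof.
rewrite cat_uniq !map_inj_uniq ?iota_uniq /= ?andbT; last first.
- by move=> i j [].
- by move=> i j [].
by apply/hasPn => _ /mapP[i _ ->]; apply/mapP => -[].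
Qed.

Lemma mem_zseq B (t : int) : (`|t| < B)%N -> t \in zseq B.
Proof.
rewrite mem_cat; case: t => i /= iB; apply/orP; [left|right]; apply: map_f;
  by rewrite mem_iota add0n; lia.
Qed.

Lemma sum_zseq (V : nmodType) (F : int -> V) B :
  \sum_(t <- zseq B) F t = \sum_(i < B) F i%:Z + \sum_(i < B) F (Negz i).
Proof.
rewrite /zseq; have -> : iota 0 B = index_iota 0 B by rewrite /index_iota subn0.
by rewrite /zseq big_cat !big_map /= !big_mkord.
Qed.

Section GBinomial.
Variable C : fieldType.
Hypothesis natS_neq0 : forall n, n.+1%:R != 0 :> C.

Lemma gbinomE (m : rat) i : gbinom C m i = fbinom (ratr m : C) i.
Proof. by []. Qed.

Lemma gbinom_nat n i : gbinom C n%:R i = 'C(n, i)%:R.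
Proof. by rewrite gbinomE ratr_nat fbinom_nat. Qed.

Lemma gbinom_neg k i : gbinom C (- k%:R - 1) i = (-1) ^+ i * 'C(k + i, i)%:R.
Proof.
rewrite gbinomE (_ : - k%:R - 1 = (Negz k)%:~R); last first.
  by rewrite NegzE mulrNz -pmulrn -natr1 opprD.
rewrite ratr_int NegzE mulrNz -pmulrn -natr1 opprD.
by rewrite fbinom_neg.
Qed.

End GBinomial.

Section JacobiRHS.
Variables (C : fieldType) (V : vectType C) (c : int -> V) (B : nat).
Hypothesis natS_neq0 : forall n, n.+1%:R != 0 :> C.
Hypothesis cB : forall t, c t != 0 -> (`|t| < B)%N.

Let cposB i : (B <= i)%N -> c i%:Z = 0.
Proof. by move=> Bi; apply/eqP; apply: contraT => /cB /=; lia. Qed.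

Let cnegB i : (B <= i)%N -> c (Negz i) = 0.
Proof. by move=> Bi; apply/eqP; apply: contraT => /cB /=; lia. Qed.

(** Here [c t] stands for [u_(m+t) v_(n+l-t) w] with [l = -1-k]. The first half of the right-hand
    side gives the terms [t <= -1-k], the second the terms [t >= 0], both with coefficient
    [binom(-t-1, k)], which is 0 for the missing [-k <= t <= -1]. *)
Lemma jacobi_rhs_neg k :
  \sum_(i \in [set: nat]) (gbinom C (Negz k)%:~R i * (-1) ^+ i) *:
     (c (Negz k - i%:Z) + ((-1) ^ (Negz k + 1)) *: c i%:Z)
  = \sum_(t <- zseq B) gbinom C (- t%:~R - 1) k *: c t.
Proof.
have nk j : (Negz j)%:~R = - j%:R - 1 :> rat.
  by rewrite NegzE mulrNz -pmulrn -natr1 opprD.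
have sgn : (-1 : C) ^ (Negz k + 1) = (-1) ^+ k.
  have -> : Negz k + 1 = - k%:Z by lia.
  by rewrite -exprnN -exprVn invrN1.
have nkE i : Negz k - i%:Z = Negz (k + i) by lia.
have iotaE : iota 0 B = index_iota 0 B by rewrite /index_iota subn0.
rewrite (@finsum_seq _ _ (iota 0 B)) ?iota_uniq; last 2 first.
- by [].
- move=> i; rewrite mem_iota /= add0n; apply: contraR; rewrite -leqNgt => Bi.
  by rewrite nkE cposB // cnegB ?scaler0 ?addr0 ?scaler0 // (leq_trans Bi)
    // leq_addl.
rewrite iotaE big_mkord sum_zseq addrC.
under eq_bigr => i _.
  rewrite nkE sgn nk (gbinom_neg natS_neq0)
    mulrAC -expr2 sqrr_sign mul1r scalerDr scalerA.
  over.
rewrite big_split /= addrC; congr (_ + _).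
  apply: eq_bigr => i _; rewrite (gbinom_neg natS_neq0); congr (_ *: _).
  by rewrite mulrC addnC -[in RHS]bin_sub ?leq_addl // addnK.
rewrite -(big_mkord xpredT (fun i => 'C(k + i, i)%:R *: c (Negz (k + i)))).
rewrite -(big_mkord xpredT (fun i =>
  gbinom C (- (Negz i)%:~R - 1) k *: c (Negz i))).
have gE i : gbinom C (- (Negz i)%:~R - 1) k = 'C(i, k)%:R.
  by rewrite nk opprD opprK addrK (gbinom_nat natS_neq0).
transitivity (\sum_(0 <= i < k + B) 'C(i, k)%:R *: c (Negz i)).
  rewrite (big_cat_nat (leq0n k) (leq_addr B k)) /=.
  rewrite [X in _ = X + _]big_nat [X in _ = X + _]big1 ?add0r.
    rewrite [RHS](big_addn 0 (k + B) k) addKn; apply: eq_bigr => i _.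
    by rewrite addnC -[in RHS]bin_sub ?leq_addl // addnK.
  by move=> i /andP[_ ik]; rewrite bin_small // scale0r.
rewrite (big_cat_nat (leq0n B) (leq_addl k B))
  /= [X in _ + X = _]big_nat [X in _ + X = _]big1 ?addr0.
  by apply: eq_bigr => i _; rewrite gE.
by move=> i /andP[Bi _]; rewrite cnegB ?scaler0.
Qed.

(** Under the reflection of [i] to [l - i] the two halves have opposite signs. *)
Lemma jacobi_rhs_nat (l : nat) :
  \sum_(i \in [set: nat]) (gbinom C l%:Z%:~R i * (-1) ^+ i) *:
     (c (l%:Z - i%:Z) + ((-1) ^ (l%:Z + 1)) *: c i%:Z) = 0.
Proof.
have lE : l%:Z%:~R = l%:R :> rat by [].
have sgn : (-1 : C) ^ (l%:Z + 1) = (-1) ^+ l.+1.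
  by have -> : l%:Z + 1 = l.+1%:Z by lia.
have iotaE : iota 0 l.+1 = index_iota 0 l.+1 by [].
rewrite (@finsum_seq _ _ (iota 0 l.+1)) ?iota_uniq; last 2 first.
- by [].
- move=> i; rewrite mem_iota /= add0n; apply: contraR; rewrite -leqNgt => li.
  by rewrite lE (gbinom_nat natS_neq0) bin_small // mul0r scale0r.
rewrite iotaE big_mkord sgn.
under eq_bigr => i _ do rewrite lE (gbinom_nat natS_neq0) scalerDr scalerA.
rewrite big_split /= [X in _ + X](reindex_inj rev_ord_inj) /= -big_split.
apply: big1 => i _ /=; rewrite subSS bin_sub -1?ltnS //.
have il : (i <= l)%N by rewrite -ltnS.
rewrite subzn // -scalerDl -[X in _ + X]mulrA -exprD.
have -> : (l - i + l.+1 = 2 * (l - i) + i.+1)%N by lia.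
by rewrite exprD exprM sqrrN !expr1n mul1r exprS mulN1r mulrN subrr scale0r.
Qed.

End JacobiRHS.

Lemma in_coset_sub p r i j : in_coset p r i -> in_coset p r j ->
  i - j \is a Num.int.
Proof.
move=> hi hj; have -> : i - j = (i - r%:R / p%:R) - (j - r%:R / p%:R) by ring.
exact: rpredB.
Qed.

Section MulModes.
Variables (C : numClosedFieldType) (M : vectType C) (p : nat).
Variables (U V : rat -> 'End(M)) (m : rat).
Hypotheses (lU : laurent p U) (lV : laurent p V).
Hypothesis gU : forall q, U (- q - 1) != 0 -> q - m \is a Num.int.

(** Truncation of [U] bounds [d] below, truncation of [V] bounds it above, and the grading of [U]
    confines it to one coset of the integers. *)
Lemma mul_modes_supp e : exists B, forall d, U d != 0 -> V (e - d) != 0 ->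
  exists t : int, d = - (m + t%:~R) - 1 /\ (`|t| < B)%N.
Proof.
have [_ [NU NUP]] := lU; have [_ [NV NVP]] := lV.
pose X := `|NU| + `|e| + `|NV| + `|m| + 1.
exists (Num.truncn X).+1 => d Ud Vd.
have dU : NU <= d by rewrite leNgt; apply: contra_neqN Ud => /NUP.
have dV : NV <= e - d by rewrite leNgt; apply: contra_neqN Vd => /NVP.
have dE : d = - (- d - 1) - 1 by rewrite opprB opprK addrAC subrr add0r.
have /intrP[t tE] : (- d - 1) - m \is a Num.int by apply: gU; rewrite -dE.
exists t; split; first by rewrite -tE; ring.
rewrite ltnS truncn_ge_nat; last by rewrite /X !addr_ge0.
have -> : `|t|%N%:R = `|- d - 1 - m| :> rat by rewrite tE natr_absz intr_norm.
have := ler_norm NU; have := ler_norm (- NU); have := ler_norm e.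
have := ler_norm (- e); have := ler_norm NV; have := ler_norm (- NV).
have := ler_norm m; have := ler_norm (- m); rewrite !normrN /X ler_norml.
by move=> *; apply/andP; split; lra.
Qed.

(** Valid for every large [B], so that one window can serve several products at once. *)
Lemma mul_modes e : exists B0, forall B, (B0 <= B)%N ->
  \sum_(d \in [set: rat]) (U d \o V (e - d))%VF
  = \sum_(t <- zseq B) (U (- (m + t%:~R) - 1) \o V (e + (m + t%:~R) + 1))%VF.
Proof.
have [B0 BP] := mul_modes_supp e; exists B0 => B B0B.
pose q (t : int) : rat := - (m + t%:~R) - 1.
have qI : injective q.
  by move=> s t /addIr/oppr_inj/addrI/eqP; rewrite eqr_int => /eqP.
rewrite (@finsum_seq _ _ [seq q t | t <- zseq B]) ?map_inj_uniq ?zseq_uniq //.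
  rewrite big_map; apply: eq_bigr => t _; rewrite /q.
  by congr (_ \o V _)%VF; ring.
move=> d UV; have [||t [-> tB]] := BP d.
- by apply: contraNneq UV => ->; rewrite comp_lfun0l.
- by apply: contraNneq UV => ->; rewrite comp_lfun0r.
by apply/map_f/mem_zseq; apply: leq_trans B0B.
Qed.

Hypothesis cUV : forall d e, (U d \o V e = V e \o U d)%VF.

(* For commuting series only the modes [u_(m+t) v_(n+l-t)] occur, with
   coefficients that cancel for [l >= 0] and combine to binomials for [l < 0]. *)
Lemma jacobi_rhs (n : rat) (l : int) : exists B0, forall B w, (B0 <= B)%N ->
  \sum_(i \in [set: nat])
       (gbinom C l%:~R i * (-1) ^+ i) *:
         (U (- (l%:~R + m - i%:R) - 1) (V (- (n + i%:R) - 1) w)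
          + ((-1) ^ (l + 1)) *:
            V (- (l%:~R + n - i%:R) - 1) (U (- (m + i%:R) - 1) w))
  = if l is Negz k then
      \sum_(t <- zseq B) gbinom C (- t%:~R - 1) k *:
         U (- (m + t%:~R) - 1) (V (- (n + l%:~R - t%:~R) - 1) w)
    else 0.
Proof.
(* The exponents of the two modes in each [c t] add up to [e0]. *)
pose e0 := - (m + n + l%:~R) - 2.
have [B0 B0P] := mul_modes_supp e0; exists B0 => B w B0B.
pose c (t : int) : M := U (- (m + t%:~R) - 1) (V (- (n + l%:~R - t%:~R) - 1) w).
have cB t : c t != 0 -> (`|t| < B)%N.
  move=> nz; have [||t' [tE tB]] := B0P (- (m + t%:~R) - 1).
  - by apply: contraNneq nz => u0; rewrite /c u0 zero_lfunE.
  - apply: contraNneq nz => v0; rewrite /c.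
    rewrite (_ : - (n + _ - _) - 1 = e0 - (- (m + t%:~R) - 1));
      last by rewrite /e0; ring.
    by rewrite v0 zero_lfunE linear0.
  suff -> : t = t' by apply: leq_trans B0B.
  by move: tE => /addIr/oppr_inj/addrI/eqP; rewrite eqr_int => /eqP.
have rhsE i : U (- (l%:~R + m - i%:R) - 1) (V (- (n + i%:R) - 1) w)
      + ((-1) ^ (l + 1)) *: V (- (l%:~R + n - i%:R) - 1) (U (- (m + i%:R) - 1)
        w)
    = c (l - i%:Z) + ((-1) ^ (l + 1)) *: c i%:Z.
  congr (_ + _ *: _); rewrite /c.
    by rewrite rmorphB /= -pmulrn; congr (U _ (V _ _)); ring.
  rewrite -pmulrn -!comp_lfunE -cUV !comp_lfunE.
  by congr (U _ (V _ _)); ring.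
under eq_fsbigr => i _ do rewrite rhsE.
have nz : forall n, n.+1%:R != 0 :> C by move=> *; rewrite pnatr_eq0.
case: l @c @e0 B0P cB {rhsE} => [l|k] c e0 B0P cB.
  exact: jacobi_rhs_nat.
exact: jacobi_rhs_neg.
Qed.

End MulModes.

(** * From homomorphisms to twisted modules *)

Section HomOfPuiseux.
Context (C : numClosedFieldType) (M : vectType C) (S : commalg M).

Lemma cval_coefM (u v : puiseux (celt S)) e : cval (coef (u * v) e) =
  \sum_(d \in [set: rat]) (cval (coef u d) \o cval (coef v (e - d)))%VF.
Proof.
have [r [ur rP]] := pconv_finite_support e (coefP u) (coefP v).
rewrite coefpM /pconv !(@finsum_seq _ _ r) //.
- by rewrite cval_sum.
- move=> d uv; apply: rP.
    by apply: contraNneq uv => ->; rewrite cval0 comp_lfun0l.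
  by apply: contraNneq uv => ->; rewrite cval0 comp_lfun0r.
- move=> d uv; apply: rP.
    by apply: contraNneq uv => ->; rewrite mul0r.
  by apply: contraNneq uv => ->; rewrite mulr0.
Qed.

Context (A : comAlgType C) (D : derivation A) (zeta : nat -> C) (g : A -> A).
Variables (p : nat) (z : {rmorphism A -> puiseux (celt S)}).
Definition opseries a e : 'End(M) := cval (coef (z a) e).
Hypothesis lin : forall e, linear (fun a => opseries a e).
Hypothesis der : forall a e,
  opseries (D a) e = ratr (e + 1) *: opseries a (e + 1).
Hypothesis lau : forall a, laurent p (opseries a).
Hypothesis grad : forall r u, (r < p)%N -> eigen zeta g p r u ->
    forall i, mode opseries u i != 0 -> in_coset p r i.

Lemma opseries0 e : opseries 0 e = 0.
Proof. by rewrite /opseries rmorph0. Qed.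

Lemma opseriesZ c a e : opseries (c *: a) e = c *: opseries a e.
Proof. by have := lin e c a 0; rewrite opseries0 !addr0. Qed.

Lemma opseries1 e : opseries 1 e = if e == 0 then \1%VF else 0.
Proof. by rewrite /opseries rmorph1 coefp1; case: ifP. Qed.

Lemma opseriesM a b e : opseries (a * b) e =
  \sum_(d \in [set: rat]) (opseries a d \o opseries b (e - d))%VF.
Proof. by rewrite /opseries rmorphM cval_coefM. Qed.

Lemma opseries_comm a b d e :
  (opseries a d \o opseries b e = opseries b e \o opseries a d)%VF.
Proof. by apply: ca_comm; apply: celtP. Qed.

(** The [j]-th divided derivative of [x^(e+j)] is [binom(e+j, j) x^e]. *)
Lemma opseries_iter_der j a e :
  ((j`!)%:R^-1 : C) *: opseries (iter j D a) e = gbinom C (e + j%:R) j *: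
    opseries a (e + j%:R).
Proof.
suff H : opseries (iter j D a) e = ((j`!)%:R * gbinom C (e + j%:R) j) *:
  opseries a (e + j%:R).
  by rewrite H scalerA mulrA mulVf ?mul1r // pnatr_eq0 -lt0n fact_gt0.
elim: j a e => [|j IH] a e.
  by rewrite gbinomE fbinom0 mulr1 scale1r addr0.
rewrite iterSr IH der scalerA -addrA natr1; congr (_ *: _).
have factgb x k : k`!%:R * gbinom C x k = \prod_(i < k) (ratr x - i%:R).
  by rewrite gbinomE /fbinom mulrC divfK // pnatr_eq0 -lt0n fact_gt0.
rewrite !factgb big_ord_recl subr0 mulrC; congr (_ * _).
apply: eq_bigr => i _; rewrite lift0 !rmorphD /= !ratr_nat -!natr1.
by ring.
Qed.

(* The left-hand side of the Jacobi identity reduces to [jacobi_rhs] by the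
   Chu-Vandermonde identity, once [(D^j u)_(m+j+t)] is written as a multiple of
   [u_(m+t)]. *)
Lemma hom_twisted_module : twisted_module D zeta g p opseries.
Proof.
split=> //.
- by move=> a; case: (lau a).
- move=> u w; have [bil [N NP]] := lau u; split.
    by move=> e ue; apply: bil; apply: contraNneq ue => ->; rewrite zero_lfunE.
  by exists N => e /NP ->; rewrite zero_lfunE.
- exact: opseries1.
move=> r s u v m n l w rp sp eu ev cm cn.
have gu q : opseries u (- q - 1) != 0 -> q - m \is a Num.int.
  by move/(grad rp eu)/in_coset_sub; apply.
have [B0 B0P] := jacobi_rhs (lau u) (lau v) gu (opseries_comm u v) n l.
case: l B0P => [l|k] B0P.
  rewrite [RHS](B0P B0 w (leqnn _)) fsbig1 // => i _.
  have -> : va_mode D (l%:Z + i%:Z) u v = 0 by [].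
  by rewrite [mode _ _ _]opseries0 zero_lfunE scaler0.
(* With [j = k - i] derivatives on [u], the modes of [D^j u] lie in the coset shifted by [j], and
   [ei j] is the exponent of the mode [m + n - i]. *)
pose mi j := m + j%:R; pose ei j := - (m + n - (k - j)%N%:R) - 1.
have gui j q : opseries (iter j D u) (- q - 1) != 0 -> q - mi j \is a Num.int.
  move=> nz; have : opseries u (- (q - j%:R) - 1) != 0.
    apply: contraNneq nz => u0; have := opseries_iter_der j u (- q - 1).
    rewrite (_ : - q - 1 + j%:R = - (q - j%:R) - 1) ?u0 ?scaler0; last by ring.
    move/eqP; rewrite scaler_eq0 invr_eq0 pnatr_eq0 => /orP[|/eqP->//].
    by rewrite eqn0Ngt fact_gt0.
  by move/gu; rewrite /mi opprD addrA addrAC.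
have [b bP] := choice (fun j =>
  mul_modes (lau (iter j D u)) (lau v) (@gui j) (ei j)).
pose B := (B0 + \sum_(j < k.+1) b j)%N.
rewrite [RHS](B0P B w) ?leq_addr //.
pose c (t : int) := opseries u (- (m + t%:~R) - 1)
  (opseries v (- (n + (Negz k)%:~R - t%:~R) - 1) w).
have iotaE : iota 0 k.+1 = index_iota 0 k.+1 by [].
rewrite (@finsum_seq _ _ (iota 0 k.+1)) ?iota_uniq //; last first.
  move=> i; rewrite mem_iota /= add0n; apply: contraR; rewrite -leqNgt => ki.
  have [j ->] : exists j : nat, Negz k + i%:Z = j%:Z by exists (i - k.+1)%N;
    lia.
  by rewrite [mode _ _ _]opseries0 zero_lfunE scaler0.
rewrite iotaE big_mkord.
transitivity (\sum_(i < k.+1) \sum_(t <- zseq B)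
   (gbinom C m i * gbinom C (- (m + t%:~R) - 1) (k - i)) *: c t).
  apply: eq_bigr => i _; have ik : (i <= k)%N by rewrite -ltnS.
  have -> : Negz k + i%:Z = Negz (k - i) by lia.
  rewrite /va_mode /mode opseriesZ scale_lfunE.
  have -> : - (m + n - i%:R) - 1 = ei (k - i)%N by rewrite /ei subKn.
  have bB : (b (k - i) <= B)%N.
    rewrite /B; have ki : (k - i < k.+1)%N by rewrite ltnS leq_subr.
    by rewrite (bigD1 (Ordinal ki)) //= addnCA leq_addr.
  rewrite opseriesM (bP _ _ bB) sum_lfunE !scaler_sumr; apply: eq_bigr => t _.
  rewrite -[in RHS]scalerA; congr (_ *: _); rewrite comp_lfunE.
  set x := opseries v _ w.
  have /lfunP/(_ x) := opseries_iter_der (k - i) u (- (mi (k - i)%N + t%:~R)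
    - 1).
  rewrite !scale_lfunE => ->; rewrite /c /x.
  have -> : - (mi (k - i)%N + t%:~R) - 1 + (k - i)%N%:R = - (m + t%:~R) - 1.
    by rewrite /mi; ring.
  congr (_ *: opseries u _ (opseries v _ _)).
  by rewrite /ei /mi subKn // NegzE mulrNz -pmulrn -natr1 natrB //; ring.
rewrite exchange_big /=; apply: eq_bigr => t _.
rewrite -scaler_suml; congr (_ *: _).
transitivity (\sum_(i < k.+1) fbinom (ratr m : C) i *
   fbinom (ratr (- (m + t%:~R) - 1) : C) (k - i)); first by [].
(* The upper arguments [m] and [-(m+t)-1] add up to [-t-1]. *)
rewrite vandermonde; last by move=> *; rewrite pnatr_eq0.
by rewrite gbinomE -rmorphD /=; congr (fbinom (ratr _) _); ring.
Qed.

End HomOfPuiseux.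

(** * From twisted modules to homomorphisms *)

Lemma laurent_grid (V : zmodType) p (f : rat -> V) : (0 < p)%N -> laurent p f ->
  exists N : nat, forall e, f e != 0 ->
    exists k : nat, e = (k%:R - N%:R) / p%:R.
Proof.
move=> p0 [bil [N NP]]; have p0' : 0 < p%:R :> rat by rewrite ltr0n.
exists (Num.truncn (`|N| * p%:R)).+1 => e fe; have /intrP[t tE] := bil e fe.
have Ne : N <= e by rewrite leNgt; apply: contra_neqN fe => /NP.
set b := (Num.truncn _).+1.
have bN : `|N| * p%:R <= b%:R.
  by apply/ltW/truncnS_gt.
have tb : 0 <= t + b%:Z.
  rewrite -(ler0z rat) rmorphD /= -tE -pmulrn;
    apply: le_trans (_ : - b%:R + b%:R <= _).
    by rewrite addNr.
  rewrite lerD2r; apply: le_trans (_ : - (`|N| * p%:R) <= _);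
    first by rewrite lerN2.
  rewrite -mulNr ler_pM2r //; apply: le_trans Ne; have := ler_norm (- N).
  by rewrite normrN; lra.
exists `|(t + b%:Z)%R|%N; rewrite natr_absz ger0_norm // rmorphD /= -tE -pmulrn
  addrK.
by rewrite mulfK // gt_eqF.
Qed.

Lemma coef_alg_subalgebra (C : fieldType) (A : comAlgType C) (M : vectType C)
  (Y : A -> rat -> 'End(M)) : subalgebra (coef_alg Y).
Proof.
split.
- by move=> S [sS _]; apply: sa_one sS.
- by move=> c X X' SX SX' S [sS gS]; apply: (sa_lin sS); [apply: SX|apply: SX'].
by move=> X X' SX SX' S [sS gS]; apply: (sa_mul sS); [apply: SX|apply: SX'].
Qed.

Lemma coef_alg_gen (C : fieldType) (A : comAlgType C) (M : vectType C)
  (Y : A -> rat -> 'End(M)) a e : coef_alg Y (Y a e).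
Proof. by move=> S [sS gS]; apply: gS; exists a, e. Qed.

Section Centralizer.
Variables (C : fieldType) (M : vectType C).

Definition centralizer (T : set 'End(M)) : set 'End(M) :=
  fun X => forall Z, T Z -> (X \o Z)%VF = (Z \o X)%VF.

Lemma centralizer_subalgebra T : subalgebra (centralizer T).
Proof.
split=> [Z _|c X Y hX hY Z TZ|X Y hX hY Z TZ].
- by rewrite comp_lfun1l comp_lfun1r.
- by rewrite comp_lfunDl comp_lfunDr -comp_lfunZl -comp_lfunZr hX // hY.
by rewrite -comp_lfunA hY // comp_lfunA hX // comp_lfunA.
Qed.

(** Minimality is used twice: the generated algebra lies in the centralizer of the generators, and
    hence in its own centralizer. *)
Lemma coef_alg_comm (A : comAlgType C) (Y : A -> rat -> 'End(M)) :
  (forall a b d e, (Y a d \o Y b e = Y b e \o Y a d)%VF) ->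
  forall X Z, coef_alg Y X -> coef_alg Y Z -> (X \o Z = Z \o X)%VF.
Proof.
move=> Yc; pose gens : set 'End(M) := [set X | exists a e, X = Y a e]%classic.
have gc X : coef_alg Y X -> centralizer gens X.
  apply; split; first exact: centralizer_subalgebra.
  by move=> _ [a [e ->]] _ [b [d ->]]; apply: Yc.
move=> X Z hX; apply: (hX (centralizer (coef_alg Y))) ; split.
  exact: centralizer_subalgebra.
by move=> T [a [e ->]] U /gc ->//; exists a, e.
Qed.

End Centralizer.

Section EigenDecomposition.
Context (C : fieldType) (A : comAlgType C) (zeta : nat -> C) (g : A ->
  A) (p : nat).
Hypotheses (p0 : (0 < p)%N) (hz : p.-primitive_root (zeta p)) (pC :
  p%:R != 0 :> C).
Hypotheses (glin : linear g) (gp : forall a, iter p g a = a).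

(** The components are the images under the Fourier projectors [1/p sum_k zeta^(-r k) g^k] of the
    cyclic group; orthogonality of characters makes them add up to [a]. *)
Lemma eigen_sum a : exists f : 'I_p ->
  A, (forall r : 'I_p, eigen zeta g p r (f r)) /\
  a = \sum_(r < p) f r.
Proof.
set w := zeta p; have wp : w ^+ p = 1 := prim_expr_order hz.
have w0 : w != 0.
  apply/eqP => w00; move: wp; rewrite w00 expr0n eqn0Ngt p0 => /esym/eqP.
  by rewrite oner_eq0.
have g0 : g 0 = 0 by have := glin (-1) 0 0;
  rewrite scaler0 addr0 scaleN1r addNr.
have gZ c b : g (c *: b) = c *: g b by have := glin c b 0; rewrite g0 !addr0.
have gD b c : g (b + c) = g b + g c by have := glin 1 b c; rewrite !scale1r.
have gsum n (F : nat -> A) :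
  g (\sum_(0 <= k < n) F k) = \sum_(0 <= k < n) g (F k).
  elim: n => [|n IH]; first by rewrite !big_geq.
  by rewrite !big_nat_recr //= gD IH.
exists (fun r => (p%:R : C)^-1 *: \sum_(0 <= k < p) w^-1 ^+ (r * k) *:
  iter k g a).
split=> [r|].
  rewrite /eigen gZ gsum scalerA [_ * _^-1]mulrC -scalerA; congr (_ *: _).
  have e k : g (w^-1 ^+ (r * k) *: iter k g a) = w ^+ r *:
    (w^-1 ^+ (r * k.+1) *: iter k.+1 g a).
    rewrite gZ scalerA; congr (_ *: _);
      rewrite mulnS exprD mulrA -exprMn mulfV //.
    by rewrite expr1n mul1r.
  rewrite (eq_bigr _ (fun k _ => e k)) -scaler_sumr; congr (_ *: _).
  pose f k := w^-1 ^+ (r * k) *: iter k g a.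
  have fp : f p = f 0%N.
    by rewrite /f muln0 expr0 mulnC exprM exprVn wp invr1 expr1n gp.
  rewrite -[LHS]/(\sum_(0 <= k < p) f k.+1) -[RHS]/(\sum_(0 <= k < p) f k).
  apply: (addIr (f 0%N)); rewrite -[in RHS]fp -big_nat_recr //=.
  by rewrite addrC -big_nat_recl.
rewrite -scaler_sumr; under eq_bigr do rewrite big_mkord.
rewrite exchange_big /= (bigD1 (Ordinal p0)) //= [X in _ + X]big1 ?addr0.
  under eq_bigr do rewrite muln0 expr0 scale1r.
  by rewrite sumr_const card_ord -scaler_nat scalerA mulVf ?scale1r.
move=> k k0; rewrite -scaler_suml; set x := w^-1 ^+ k.
have -> : \sum_(r < p) w^-1 ^+ (r * k) = \sum_(r < p) x ^+ r.
  by apply: eq_bigr => r _; rewrite -exprM mulnC.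
have x1 : x != 1.
  rewrite /x exprVn invr_eq1 -(prim_order_dvd hz); apply: contra k0 => pk.
  by apply/eqP/val_inj => /=; apply/eqP; rewrite -leqn0 leqNgt;
    apply: contraTN pk => kp;
    rewrite gtnNdvd.
have xp : x ^+ p = 1 by rewrite /x -exprM mulnC exprM exprVn wp invr1 expr1n.
have := subrX1 x p; rewrite xp subrr => /esym/eqP.
rewrite mulf_eq0 subr_eq0 (negPf x1) => /eqP ->.
by rewrite scale0r.
Qed.

(** The Jacobi identity is about eigenvectors; additive consequences extend to all of [A]. *)
Lemma eigen_ind (P : A -> Prop) :
  (forall a b, P a -> P b -> P (a + b)) -> P 0 ->
  (forall (r : nat) a, (r < p)%N -> eigen zeta g p r a -> P a) -> forall a, P a.
Proof.
move=> PD P0 Pe a; have [f [fe ->]] := eigen_sum a.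
by apply: big_ind => // r _; apply: Pe (fe r).
Qed.

End EigenDecomposition.

Section HomOfTwisted.
Context (C : numClosedFieldType) (A : comAlgType C) (D : derivation A).
Context (zeta : nat -> C) (g : A -> A) (p : nat) (M : vectType C).
Context (Y : A -> rat -> 'End(M)).
Hypotheses (p0 : (0 < p)%N) (hz : p.-primitive_root (zeta p)).
Hypotheses (glin : linear g) (gp : forall a, iter p g a = a).
Hypothesis tw : twisted_module D zeta g p Y.
Hypothesis lau : forall a, laurent p (Y a).
Hypothesis M0 : (fullv : {vspace M}) != 0%VS.

Let pC : p%:R != 0 :> C. Proof. by rewrite pnatr_eq0 -lt0n. Qed.

Lemma twD a b e : Y (a + b) e = Y a e + Y b e.
Proof. by have := tw_linear tw e 1 a b; rewrite !scale1r. Qed.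

Lemma tw0 e : Y 0 e = 0.
Proof. by have := tw_linear tw e (-1) 0 0;
  rewrite scaler0 addr0 scaleN1r addNr. Qed.

Lemma mode_coset r u e : (r < p)%N -> eigen zeta g p r u -> Y u e != 0 ->
  in_coset p r (- e - 1).
Proof.
move=> rp eu nz; apply: (tw_grading tw rp eu).
by rewrite /mode (_ : - (- e - 1) - 1 = e) //; ring.
Qed.

(** The case [l = 0]: the left-hand side vanishes, as [u_i v = 0] for [i >= 0], and the term [i = 0]
    on the right is the commutator. *)
Lemma tw_comm_eigen r s u v d e : (r < p)%N -> (s < p)%N ->
  eigen zeta g p r u -> eigen zeta g p s v ->
    (Y u d \o Y v e = Y v e \o Y u d)%VF.
Proof.
move=> rp sp eu ev.
have [->|ud] := eqVneq (Y u d) 0; first by rewrite comp_lfun0l comp_lfun0r.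
have [->|ve] := eqVneq (Y v e) 0; first by rewrite comp_lfun0l comp_lfun0r.
apply/lfunP => w.
have := tw_jacobi tw 0 w rp sp eu ev (mode_coset rp eu ud)
  (mode_coset sp ev ve).
rewrite fsbig1 => [|i _]; last first.
  have -> : va_mode D (0 + i%:Z) u v = 0 by [].
  by rewrite [mode _ _ _]tw0 zero_lfunE scaler0.
rewrite (@finsum_seq _ _ [:: 0%N]) //; last first.
  move=> [|i] //; rewrite -[0%:~R]/(0%N%:R)
    gbinom_nat ?bin0n ?mul0r ?scale0r ?eqxx //.
  by move=> *; rewrite pnatr_eq0.
rewrite big_seq1 gbinomE fbinom0 expr0 mulr1 scale1r.
rewrite !mulr0n mulr0z !addr0 ?subr0 !add0r expr1z scaleN1r /mode.
have E x : - (- x - 1) - 1 = x :> rat by ring.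
by rewrite !E => /esym/eqP; rewrite subr_eq0 !comp_lfunE => /eqP.
Qed.

Lemma tw_comm a b d e : (Y a d \o Y b e = Y b e \o Y a d)%VF.
Proof.
move: a; apply: (eigen_ind p0 hz pC glin gp) => [a a' h h'||r a rp ea].
- by rewrite twD comp_lfunDl comp_lfunDr h h'.
- by rewrite tw0 comp_lfun0l comp_lfun0r.
move: b; apply: (eigen_ind p0 hz pC glin gp) => [b b' h h'||s b sp eb].
- by rewrite twD comp_lfunDl comp_lfunDr h h'.
- by rewrite tw0 comp_lfun0l comp_lfun0r.
exact: tw_comm_eigen rp sp ea eb.
Qed.

Definition coef_commalg : commalg M :=
  CommAlg (coef_alg_subalgebra Y) (coef_alg_comm tw_comm) M0.

Fact tw_series_subproof a :
  (fun e => @celt_of _ _ coef_commalg (Y a e) (coef_alg_gen a e))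
  \in [pred f : rat -> celt coef_commalg | `[< pfun f >]].
Proof.
apply/asboolP; have [N NP] := laurent_grid p0 (lau a); exists p, N; by split.
Qed.

Definition tw_series a : puiseux (celt coef_commalg)
  := Puiseux (tw_series_subproof a).

Lemma tw_seriesD a b : tw_series (a + b) = tw_series a + tw_series b.
Proof. by apply: coef_inj => e; apply: val_inj; rewrite /= twD. Qed.

Lemma tw_series0 : tw_series 0 = 0.
Proof. by apply: coef_inj => e; apply: val_inj; rewrite /= tw0. Qed.

Hypothesis gM : forall a b, g (a * b) = g a * g b.

(** The case [l = -1]: on the left only [u_(-1) v = u v] survives, and on the right the coefficients
    [binom(-t-1, 0) = 1] leave the Cauchy product. *)
Lemma tw_mul_eigen r s u v : (r < p)%N -> (s < p)%N ->
  eigen zeta g p r u -> eigen zeta g p s v ->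
    tw_series (u * v) = tw_series u * tw_series v.
Proof.
move=> rp sp eu ev; apply: coef_inj => e; apply: val_inj.
suff : Y (u * v) e = \sum_(d \in [set: rat]) (Y u d \o Y v (e - d))%VF.
  by move=> E; rewrite [RHS]cval_coefM -E.
have p0' : p%:R != 0 :> rat by rewrite pnatr_eq0 -lt0n.
(* The choice [m + n = -e-1] makes the mode of [u v] the coefficient of [x^e]. *)
pose m : rat := r%:R / p%:R; pose n := - e - 1 - m.
have cm : in_coset p r m by rewrite /in_coset subrr.
(* Where [n] misses its coset the Jacobi identity says nothing, but the gradings of [u], [v] and
   [u v] make both sides 0. *)
have [cn|ncn] := boolP (n - s%:R / p%:R \is a Num.int); last first.
  rewrite fsbig1 => [|d _]; last first.
    apply/eqP; apply: contraT => nz; case/negP: ncn.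
    have ud : Y u d != 0 by apply: contraNneq nz => ->; rewrite comp_lfun0l.
    have vd : Y v (e - d) != 0 by apply: contraNneq nz => ->;
      rewrite comp_lfun0r.
    have -> : n - s%:R / p%:R = (- d - 1 - m) + (- (e - d) - 1 - s%:R / p%:R)
      + 1.
      by rewrite /n; ring.
    apply: rpredD; last exact: rpred1.
    by apply: rpredD; [exact: mode_coset rp eu ud | exact: mode_coset sp ev vd].
  apply/eqP; apply: contraT => nz; case/negP: ncn.
  have euv : eigen zeta g p ((r + s) %% p) (u * v).
    by rewrite /eigen gM eu ev -scalerAl -scalerAr scalerA (prim_expr_mod hz)
      exprD.
  have := mode_coset (ltn_pmod (r + s) p0) euv nz; rewrite /in_coset.
  have -> : n - s%:R / p%:R = (- e - 1 - ((r + s) %% p)%:R / p%:R) - ((r + s)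
    %/ p)%:R.
    have : (r + s)%:R = ((r + s) %/ p)%:R * p%:R + ((r + s) %% p)%:R :> rat.
      by rewrite -natrM -natrD -divn_eq.
    rewrite /n /m natrD => /(canLR (addrK _)) rsE.
    have -> : ((r + s) %/ p)%:R = (r%:R + s%:R - ((r + s) %% p)%:R)
      / p%:R :> rat.
      by rewrite rsE mulfK.
    by field.
  by move=> hi; rewrite rpredB // natr_int.
have gu q : Y u (- q - 1) != 0 -> q - m \is a Num.int.
  by move/(tw_grading tw rp eu)/in_coset_sub; apply.
have [b1 b1P] := mul_modes (lau u) (lau v) gu e.
have [b2 b2P] := jacobi_rhs (lau u) (lau v) gu (tw_comm u v) n (Negz 0).
apply/lfunP => w; rewrite (b1P _ (leq_addr b2 b1)).
have := tw_jacobi tw (Negz 0) w rp sp eu ev cm cn.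
rewrite [X in _ = X -> _](b2P _ w (leq_addl b1 b2)).
rewrite (@finsum_seq _ _ [:: 0%N]) //; last first.
  move=> [|i] //; have -> : va_mode D (Negz 0 + i.+1%:Z) u v = 0 by [].
  by rewrite [mode _ _ _]tw0 zero_lfunE scaler0 eqxx.
rewrite big_seq1; have -> : va_mode D (Negz 0 + 0%N%:Z) u v = u * v.
  by change ((0`!%:R^-1 : C) *: (u * v) = u * v); rewrite fact0 invr1 scale1r.
rewrite gbinomE fbinom0 scale1r /mode.
have -> : - (m + n - 0%:R) - 1 = e by rewrite /n; ring.
move=> ->; rewrite sum_lfunE; apply: eq_bigr => t _.
rewrite gbinomE fbinom0 scale1r comp_lfunE; congr (Y u _ (Y v _ w)).
by rewrite /n NegzE; ring.
Qed.

Lemma tw_seriesM a b : tw_series (a * b) = tw_series a * tw_series b.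
Proof.
move: a; apply: (eigen_ind p0 hz pC glin gp) => [a a' h h'||r a rp ea].
- by rewrite mulrDl !tw_seriesD mulrDl h h'.
- by rewrite !(mul0r, tw_series0).
move: b; apply: (eigen_ind p0 hz pC glin gp) => [b b' h h'||s b sp eb].
- by rewrite mulrDr !tw_seriesD mulrDr h h'.
- by rewrite !(mulr0, tw_series0).
exact: tw_mul_eigen rp sp ea eb.
Qed.

Lemma tw_series1 : tw_series 1 = 1.
Proof.
apply: coef_inj => e; apply: val_inj; rewrite coefp1.
rewrite -[LHS]/(Y 1 e) (tw_vacuum tw).
by case: ifP.
Qed.

Lemma hom_of_twisted : exists z : {rmorphism A -> puiseux (celt coef_commalg)},
  forall a e, cval (coef (z a) e) = Y a e.
Proof.
have zB : zmod_morphism tw_series.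
  move=> a b; rewrite tw_seriesD; congr (_ + _); apply/eqP.
  by rewrite -subr_eq0 opprK -tw_seriesD addNr tw_series0.
have zM : monoid_morphism tw_series by split;
  [exact: tw_series1 | exact: tw_seriesM].
pose zBm := GRing.isZmodMorphism.Build _ _ tw_series zB.
pose zMm := GRing.isMonoidMorphism.Build _ _ tw_series zM.
pose zz : {rmorphism A -> puiseux (celt coef_commalg)} := HB.pack tw_series zBm
  zMm.
by exists zz.
Qed.

End HomOfTwisted.

(* For [l = -2] and [v = 1] the Jacobi identity computes [Y (D u)]. *)
Lemma va_module_der (C : numClosedFieldType) (A : comAlgType C) (D :
  derivation A)
  (zeta : nat -> C) (M : vectType C) (Y : A -> rat -> 'End(M)) :
  va_module D zeta Y -> (forall a, laurent 1 (Y a)) ->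
  forall u e, Y (D u) e = ratr (e + 1) *: Y u (e + 1).
Proof.
move=> tw lau u e.
have bil a d : Y a d != 0 -> d \is a Num.int.
  by move=> /(tw_bilateral tw); rewrite mulr1.
have eig (a : A) : eigen zeta id 1 0 a by rewrite /eigen expr0 scale1r.
have comm a b d d' : (Y a d \o Y b d' = Y b d' \o Y a d)%VF.
  exact: (tw_comm_eigen tw (r := 0%N) (s := 0%N)).
have [eint|ne] := boolP (e \is a Num.int); last first.
  have -> : Y (D u) e = 0 by apply/eqP; apply: contraNT ne; apply: bil.
  rewrite (_ : Y u (e + 1) = 0) ?scaler0 //; apply/eqP;
    apply: contraNT ne => /bil.
  by move=> h; rewrite -[e](addrK 1) rpredB ?rpred1.
have cos q : q \is a Num.int -> in_coset 1 0 q.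
  by move=> qi; rewrite /in_coset mul0r subr0.
have gu q : Y u (- q - 1) != 0 -> q - (- e) \is a Num.int.
  by move=> /bil h; rewrite (_ :
    q - - e = - (- q - 1) - 1 + e) ?rpredD ?rpredN //; ring.
(* For [m = -e], [n = -1], [l = -2] the left-hand side consists of the coefficient of [D u] at [e]
   and [-e] times that of [u] at [e + 1]. *)
have [B BP] := jacobi_rhs (lau u) (lau 1) gu (comm u 1) (-1) (Negz 1).
apply/lfunP => w.
have me : in_coset 1 0 (- e) by apply: cos; rewrite rpredN.
have := @tw_jacobi _ _ _ _ _ _ _ _ tw 0%N 0%N u 1 (- e) (-1) (Negz 1) w isT isT
   (eig u) (eig 1) me (cos (-1) isT).
have [B' [BB' B2]] : exists B', (B <= B')%N /\ (2 < B')%N by exists (B + 3)%N;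
  lia.
rewrite [X in _ = X -> _](BP _ w BB').
rewrite (@finsum_seq _ _ [:: 0%N; 1%N]) //; last first.
  move=> [|[|i]] //; have -> : va_mode D (Negz 1 + i.+2%:Z) u 1 = 0 by [].
  by rewrite [mode _ _ _](tw0 tw) zero_lfunE scaler0 eqxx.
rewrite !big_cons big_nil addr0.
have -> : va_mode D (Negz 1 + 0%N%:Z) u 1 = D u.
  by change ((1`!%:R^-1 : C) *: (D u * 1) = D u);
    rewrite (_ : 1`! = 1%N) // invr1 scale1r mulr1.
have -> : va_mode D (Negz 1 + 1%N%:Z) u 1 = u.
  by change ((0`!%:R^-1 : C) *: (u * 1) = u); rewrite fact0 invr1 scale1r mulr1.
rewrite !gbinomE fbinom0 scale1r fbinom1; last first.
  by move=> *; rewrite pnatr_eq0.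
rewrite /mode.
have -> : - (- e + -1 - 0%:R) - 1 = e by ring.
have -> : - (- e + -1 - 1%:R) - 1 = e + 1 by ring.
(* The vacuum has a single mode, which selects [t = -2]. *)
rewrite (bigD1_seq (Negz 1)) ?zseq_uniq ?mem_zseq //= big1 ?addr0; last first.
  move=> t t2; rewrite (tw_vacuum tw) ifF ?zero_lfunE ?linear0 ?scaler0 //.
  apply: contraNF t2 => /eqP te; rewrite -(eqr_int rat); apply/eqP.
  by rewrite NegzE mulrNz -pmulrn -natr1 in te *; lra.
have -> : - (Negz 1)%:~R - 1 = 1 :> rat by [].
have -> : - (- e + (Negz 1)%:~R) - 1 = e + 1 by rewrite NegzE; ring.
have -> : - (-1 + (Negz 1)%:~R - (Negz 1)%:~R) - 1 = 0 :> rat by [].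
rewrite (tw_vacuum tw) eqxx id_lfunE gbinomE fbinom1; last first.
  by move=> *; rewrite pnatr_eq0.
rewrite rmorph1 scale1r => /(canRL (addrK _)) ->.
by rewrite scale_lfunE rmorphD rmorph1 rmorphN scaleNr opprK scalerDl scale1r
  addrC.
Qed.

(** * The map psi *)

(* Finite-dimensionality makes the truncation condition uniform in the vector. *)
Lemma twisted_laurent (C : fieldType) (A : comAlgType C) (D : derivation A)
    (zeta : nat -> C) (g : A -> A) (p : nat) (M : vectType C)
    (Y : A -> rat -> 'End(M)) :
  twisted_module D zeta g p Y -> forall a, laurent p (Y a).
Proof.
move=> tw a; split; first exact: tw_bilateral tw a.
have [N NP] := choice (fun w => (tw_trunc tw a w).2).
pose b := vbasis (fullv : {vspace M}).
exists (- \sum_(w <- b) `|N w|) => e eN; apply/lfunP => v.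
have : v \in <<b>>%VS by rewrite (span_basis (vbasisP _)) memvf.
have -> : (<<b>> = <<[tuple of b]>>)%VS by congr (span _).
move/coord_span => ->; rewrite linear_sum zero_lfunE big1 // => i _.
rewrite linearZ /= NP ?scaler0 //; apply: lt_le_trans eN _.
apply: le_trans (_ : - `|N b`_i| <= _); last by rewrite lerNl -normrN ler_norm.
have bi : b`_i \in (b : seq M) by apply: mem_nth; rewrite size_tuple.
rewrite lerN2 (bigD1_seq b`_i) //= ?lerDl ?sumr_ge0 //.
exact: free_uniq (basis_free (vbasisP _)).
Qed.

Section Psi.
Context (C : numClosedFieldType) (M : vectType C) (S : commalg M).
Context (l : {rmorphism celt S -> C}).
Hypothesis lP : forall x, is_nilpotent (x - cconst S (l x)).

Definition nilradical : set 'End(M) :=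
  [set cval x | x in [set x : celt S | is_nilpotent x]]%classic.
Local Notation J := nilradical.

Let l_const c : l (cconst S c) = c.
Proof. exact: residue_const lP. Qed.

Let nil_res x : is_nilpotent x -> l x = 0.
Proof.
move=> [k xk]; have : l x ^+ k == 0 by rewrite -rmorphXn xk rmorph0.
by rewrite expf_eq0 => /andP[_ /eqP].
Qed.

Let res_nil x : l x = 0 -> is_nilpotent x.
Proof. exact: residue_eq0. Qed.

Let cvalK X (SX : ca_set S X) : exists x : celt S, cval x = X.
Proof. by exists (celt_of SX). Qed.

Lemma radical_ideal : ideal (ca_set S) J.
Proof.
split.
- by move=> _ [x _ <-]; apply: celtP.
- by exists (0 : celt S) => //; apply: nilp0.
- by move=> _ _ [x xn <-] [y yn <-]; exists (x + y) => //; apply: nilpD.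
move=> X _ /cvalK[x <-] [y yn <-]; split.
  by exists (x * y) => //; apply: nilpM.
by exists (y * x) => //; rewrite mulrC; apply: nilpM.
Qed.

Lemma radical_proper : J <> ca_set S.
Proof.
move=> JS; have : J \1%VF by rewrite JS; apply: sa_one (ca_subalgebra S).
move=> [x xn x1]; have := nil_res xn; have -> : x = 1 by apply: val_inj.
by move/eqP; rewrite rmorph1 oner_eq0.
Qed.

Lemma ideal_unit (I : set 'End(M)) x : ideal (ca_set S) I -> I (cval x) ->
  l x != 0 ->
  I = ca_set S.
Proof.
move=> idI Ix lx.
have [y yx] : invertible x.
  have -> : x = cconst S (l x) + (x - cconst S (l x)) by rewrite addrC subrK.
  apply: invertible_nilpD => //; exists (cconst S (l x)^-1).
  by rewrite -rmorphM mulVf ?rmorph1.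
apply/seteqP; split; first exact: id_sub idI.
move=> Z /cvalK[z <-]; have -> : z = z * y * x by rewrite -mulrA yx mulr1.
by have [] := id_mul idI (celtP (z * y)) Ix.
Qed.

(** An element of nonzero residue is a unit, so every proper ideal consists of nilpotents and the
    nilradical is the only maximal ideal. *)
Lemma jacobsonE (x : celt S) : jacobson (ca_set S) (cval x) <-> is_nilpotent x.
Proof.
have sub I : ideal (ca_set S) I -> I <> ca_set S -> (I `<=` J)%classic.
  move=> idI nI X IX; have /cvalK[x' xE] := id_sub idI IX.
  exists x' => //; apply: res_nil; apply/eqP; apply: contrapT => /negP lx;
    apply: nI.
  by apply: (@ideal_unit _ x') => //; rewrite xE.
split=> [[_ jac]|xn].
  have [|x' xn] := jac J.
    split; [exact: radical_ideal| exact/eqP/radical_proper |].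
    move=> I idI JI /eqP nI; apply/seteqP; split=> //; exact: sub.
  by move=> /val_inj <-.
split; first exact: celtP.
move=> I [idI /eqP nI Imax]; rewrite -(Imax J); first by exists x.
- exact: radical_ideal.
- exact: sub.
exact/eqP/radical_proper.
Qed.

(** The residue of an idempotent is 0 or 1; with residue 0 it is nilpotent and equal to its positive
    powers, hence 0, and otherwise this applies to [1 - x]. *)
Lemma celt_idempotent (x : celt S) : x * x = x -> x = 0 \/ x = 1.
Proof.
have nilidem y : y * y = y -> l y = 0 -> y = 0.
  move=> yy /res_nil[k]; case: k => [|k].
    by rewrite expr0 => /eqP; rewrite oner_eq0.
  suff -> : y ^+ k.+1 = y by [].
  by elim: k => // k IH; rewrite exprS IH.
move=> xx; have : l x * (1 - l x) == 0.
  by rewrite mulrBr mulr1 -rmorphM xx subrr.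
rewrite mulf_eq0 => /orP[/eqP lx|]; first by left; apply: nilidem.
rewrite subr_eq0 => /eqP lx; right; apply/eqP; rewrite eq_sym -subr_eq0.
apply/eqP/nilidem; last by rewrite rmorphB rmorph1 -lx subrr.
by rewrite mulrBl mul1r mulrBr mulr1 xx subrr subr0.
Qed.

Let idemE X : Defs.idempotent (ca_set S) X -> X = 0 \/ X = \1%VF.
Proof.
move=> [/cvalK[x <-] xx]; have [|->|->] := @celt_idempotent x;
  first exact: val_inj.
  by left.
by right.
Qed.

Let one_neq0 : (\1%VF : 'End(M)) != 0.
Proof. by apply/eqP => e; case/eqP: (oner_neq0 (celt S)); apply: val_inj. Qed.

Lemma idem_coords1 (x : celt S) c : idem_coords (ca_set S) [::
  \1%VF] (cval x) c <-> c = [:: l x].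
Proof.
have sumE d : \sum_(i < 1) [:: d]`_i *: [:: \1%VF :
  'End(M)]`_i = cval (cconst S d).
  by rewrite big_ord_recl big_ord0 addr0.
split=> [[]|->].
  case: c => [|d [|]] //= _; rewrite sumE -cvalB => /jacobsonE/nil_res.
  by rewrite rmorphB l_const => /eqP; rewrite subr_eq0 => /eqP ->.
by split=> //; rewrite sumE -cvalB; apply/jacobsonE.
Qed.

Lemma idem_system1 : idem_system (ca_set S) [:: \1%VF].
Proof.
split.
- move=> X; rewrite inE => /eqP ->; split=> //.
    by split; [exact: sa_one (ca_subalgebra S)| rewrite comp_lfun1l].
  move=> X1 X2 /idemE[->|->] /idemE[->|->]; rewrite ?comp_lfun1l; auto.
- by move=> [|i] [|j].
move=> X /cvalK[x <-]; exists [:: l x]; split; first exact/idem_coords1.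
by move=> c /idem_coords1.
Qed.

(** [idems] is an arbitrary choice among the systems, so computing with it takes uniqueness: all
    members are 1, orthogonality forbids two of them, and the empty system does not reach 1. *)
Lemma idem_system_eq es : idem_system (ca_set S) es -> es = [:: \1%VF].
Proof.
move=> [prim orth coords].
have es1 X : X \in es -> X = \1%VF.
  by move=> /prim[/idemE[->|//]]; rewrite eqxx.
case: es es1 orth coords {prim} => [|e [|e' es]] es1 orth coords.
- have [c [[_ c1] _]] := coords _ (sa_one (ca_subalgebra S)).
  move: c1; rewrite big_ord0 subr0 -[\1%VF]/(cval (1 : celt S)).
  by move=> /jacobsonE/nil_res/eqP; rewrite rmorph1 oner_eq0.
- by rewrite (es1 e) ?mem_head.
have := orth 0%N 1%N isT isT isT; rewrite /= (es1 e) ?mem_head // (es1 e').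
  by rewrite comp_lfun1l => /eqP; rewrite (negPf one_neq0).
by rewrite !inE eqxx orbT.
Qed.

Lemma semisimple_part_local (x : celt S) :
  semisimple_part (ca_set S) (cval x) = [:: l x].
Proof.
have idE : idems (ca_set S) = [:: \1%VF].
  apply: idem_system_eq; rewrite /idems; apply: xgetPex.
  by exists [:: \1%VF]; apply: idem_system1.
rewrite /semisimple_part idE; apply/idem_coords1; apply: xgetPex.
by exists [:: l x]; apply/idem_coords1.
Qed.

End Psi.

(** * Structures over an indecomposable module *)

Section Hadamard.
Variable A : comNzRingType.
Implicit Types u v : puiseux A.

Fact hadamard_subproof (w : rat -> A) u :
  (fun e => w e * coef u e) \in [pred f : rat -> A | `[< pfun f >]].
Proof.
apply/asboolP; have [p [N [p0 gu]]] := coefP u; exists p, N; split=> // e nz.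
by apply: gu; apply: contraNneq nz => ->; rewrite mulr0.
Qed.

(* Coefficientwise multiplication by the weights [w e]: the Euler derivation for
   [w e = e], the monodromy around [0] for [w] a character of [Z/p]. *)
Definition hadamard (w : rat ->
  A) u : puiseux A := Puiseux (hadamard_subproof w u).

Lemma hadamardB w u v : hadamard w (u - v) = hadamard w u - hadamard w v.
Proof. by apply: coef_inj => e; rewrite /= mulrBr. Qed.

Lemma hadamard_der w u v : (forall d e, w (d + e) = w d + w e) ->
  hadamard w (u * v) = u * hadamard w v + hadamard w u * v.
Proof.
move=> wD; apply: coef_inj => e; rewrite coefpD !coefpM /=.
have [r [ur rP]] := pconv_finite_support e (coefP u) (coefP v).
rewrite /pconv !(@finsum_seq _ _ r) //.
- rewrite mulr_sumr -big_split /=; apply: eq_bigr => d _.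
  by have -> : w e = w d + w (e - d); [rewrite -wD subrKC | ring].
- move=> d nz; apply: rP; apply: contraNneq nz => -> ; rewrite ?mulr0 ?mul0r //.
- move=> d nz; apply: rP; apply: contraNneq nz => -> ; rewrite ?mulr0 ?mul0r //.
by move=> d nz; apply: rP; apply: contraNneq nz => -> ; rewrite ?mulr0 ?mul0r.
Qed.

(** The weight is multiplicative on [(1/p) Z] only, whence the common denominator. *)
Lemma hadamard_char p w u v :
  (forall d e, d * p%:R \is a Num.int -> e * p%:R \is a Num.int ->
    w (d + e) = w d * w e) ->
  has_denom p u -> has_denom p v ->
  hadamard w (u * v) = hadamard w u * hadamard w v.
Proof.
move=> wM du dv; apply: coef_inj => e; rewrite !coefpM /=.
have [r [ur rP]] := pconv_finite_support e (coefP u) (coefP v).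
rewrite /pconv !(@finsum_seq _ _ r) //.
- rewrite mulr_sumr; apply: eq_bigr => d _.
  have [->|/du di] := eqVneq (coef u d) 0; first by rewrite !(mul0r, mulr0).
  have [->|/dv ei] := eqVneq (coef v (e - d)) 0; first by rewrite !mulr0.
  by have -> : w e = w d * w (e - d); [rewrite -wM ?subrKC | ring].
- move=> d nz; apply: rP; apply: contraNneq nz => -> ; rewrite ?mulr0 ?mul0r //.
by move=> d nz; apply: rP; apply: contraNneq nz => -> ; rewrite ?mulr0 ?mul0r.
Qed.

End Hadamard.

Section Inclusion.
Context (C : numClosedFieldType) (M : vectType C).

(** Nilpotency of [X - c] depends on the endomorphism alone, not on the algebra that contains it. *)
Lemma celt_residue_eq (S T : commalg M) (l : {rmorphism celt S -> C})
    (k : {rmorphism celt T -> C}) :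
  (forall x, is_nilpotent (x - cconst S (l x))) ->
  (forall x, is_nilpotent (x - cconst T (k x))) ->
  forall x y, cval x = cval y -> l x = k y.
Proof.
move=> lP kP x y xy.
have /nilp_lexp[n nE] := lP x.
have nT : is_nilpotent (y - cconst T (l x)).
  have E : cval (x - cconst S (l x)) = cval (y - cconst T (l x))
    by rewrite /= xy.
  by apply/nilp_lexp; exists n => v; rewrite -E nE.
apply/eqP; rewrite eq_sym -subr_eq0; apply/eqP;
  apply: (@nilpotent_const _ _ (cconst T)).
suff : is_nilpotent (cconst T (k y - l x)) by [].
have -> : cconst T (k y - l x) = (y - cconst T (l x)) - (y - cconst T (k y)).
  by rewrite rmorphB; ring.
by apply: nilpD => //; apply: nilpN.
Qed.

Lemma celt_inclusion (S T : commalg M) : (ca_set S `<=` ca_set T)%classic ->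
  exists f : {rmorphism celt S -> celt T}, forall x, cval (f x) = cval x.
Proof.
move=> ST; pose f (x : celt S) : celt T := celt_of (ST _ (celtP x)).
have fB : zmod_morphism f by move=> x y; apply: val_inj.
have fM : monoid_morphism f by split=> [|x y]; apply: val_inj.
pose fBm := GRing.isZmodMorphism.Build _ _ f fB.
pose fMm := GRing.isMonoidMorphism.Build _ _ f fM.
by exists (HB.pack f fBm fMm : {rmorphism celt S -> celt T}).
Qed.

Lemma puiseux_map_residue_nilp (S : commalg M) (l : {rmorphism celt S -> C}) u :
  (forall x, is_nilpotent (x - cconst S (l x))) -> puiseux_map l u = 0 ->
    is_nilpotent u.
Proof.
move=> lP lu; apply: (@puiseux_nilp _ (\dim (fullv : {vspace M}))).
  by move=> s sn sz; apply: prod_nilp0.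
by move=> e; apply: (residue_eq0 lP); rewrite -coef_puiseux_map lu coefp0.
Qed.

Lemma puiseux_map_residue_sur (S : commalg M) (l : {rmorphism celt S -> C}) u :
  (forall x, is_nilpotent (x - cconst S (l x))) ->
  exists v, puiseux_map l v = u.
Proof.
move=> lP; exists (puiseux_map (cconst S) u); apply: coef_inj => e.
by rewrite !coef_puiseux_map (residue_const _ lP).
Qed.

End Inclusion.

(** * Lifting, monodromy and conjugacy of structures *)

Section Structures.
Context (C : numClosedFieldType) (zeta : nat -> C).
Hypothesis hzeta : forall p, (0 < p)%N -> p.-primitive_root (zeta p).
Context (K : fieldAlgType C) (D : derivation K).
Context (G : finGroupType) (act : autGroup D G).
Context (M : vectType C) (Y : fixed act -> rat -> 'End(M)).
Hypothesis hY : va_module (fixed_der act) zeta Y.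
Hypothesis hM : (fullv : {vspace M}) != 0%VS.
Hypothesis hind : indecomposable Y.

Local Notation F := (fixed act).

Lemma local_commalg (S : commalg M) :
  (forall X, ca_set S X -> forall a e, (X \o Y a e)%VF = (Y a e \o X)%VF) ->
  exists l : {rmorphism celt S ->
    C}, forall x, is_nilpotent (x - cconst S (l x)).
Proof.
move=> SY; apply: exists_residue => x.
have [c [k ck]] := indecomposable_nilp hM hind (SY _ (celtP x)).
by exists c; apply/nilp_lexp; exists k.
Qed.

Lemma act_iter g n (a : K) : iter n (act g) a = act (g ^+ n)%g a.
Proof. by elim: n => [|n IH]; rewrite ?expg0 ?aut1 // expgS autM /= IH. Qed.

Lemma act_inj g h : act g =1 act h -> g = h.
Proof.
move=> gh; apply/eqP; rewrite eq_mulVg1; apply/eqP;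
  apply: (@aut_faithful _ _ _ _ act).
by move=> a; rewrite autM -gh -autM mulVg aut1.
Qed.

Lemma base_hom : exists (S : commalg M) (y : {rmorphism F -> puiseux (celt S)}),
  ca_set S = coef_alg Y /\ forall a e, cval (coef (y a) e) = Y a e.
Proof.
have lin : linear (id : F -> F) by [].
have [y yE] := hom_of_twisted (ltn0Sn 0) (hzeta (ltn0Sn 0)) lin (fun=> erefl) hY
   (twisted_laurent hY) hM (fun _ _ => erefl).
by eexists; exists y.
Qed.

Lemma structure_hom g Yt : structure_over zeta Y g Yt ->
  exists (S : commalg M) (z : {rmorphism K -> puiseux (celt S)}),
  ca_set S = coef_alg Yt /\ forall a e, cval (coef (z a) e) = Yt a e.
Proof.
move=> [tw lau _].
have lin : linear (act g) by move=> c a b; rewrite linearP.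
have gp a : iter #[g]%g (act g) a = a by rewrite act_iter expg_order aut1.
have [z zE] := hom_of_twisted (order_gt0 g) (hzeta (order_gt0 g))
  lin gp tw lau hM
   (rmorphM (act g)).
by eexists; exists z.
Qed.

Section BaseHom.
Variables (S : commalg M) (y : {rmorphism F -> puiseux (celt S)}).
Variable l : {rmorphism celt S -> C}.
Hypothesis SE : ca_set S = coef_alg Y.
Hypothesis yE : forall a e, cval (coef (y a) e) = Y a e.
Hypothesis lP : forall x, is_nilpotent (x - cconst S (l x)).
Local Notation pi := (puiseux_map l).
Implicit Type z : {rmorphism K -> puiseux (celt S)}.

Lemma hom_uniq z1 z2 : (forall a, z1 (fval act a) = z2 (fval act a)) ->
  (forall c, pi (z1 c) = pi (z2 c)) -> z1 =1 z2.
Proof.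
move=> zF piz; apply: (ext_uniq zF); apply: (puiseux_map_residue_nilp lP).
by rewrite rmorphB /= piz subrr.
Qed.

(** The residues are conjugate, having values in a domain, and uniqueness of lifts carries the
    conjugating [h] back to [S]. *)
Lemma hom_conj z1 z2 : (forall a, z1 (fval act a) = z2 (fval act a)) ->
  exists h, z2 =1 z1 \o act h.
Proof.
move=> zF; have [||h hE] := @ext_conj _ _ _ _ act (puiseux C) (pi \o z1)
  (pi \o z2).
- exact: puiseux_domain.
- by move=> a; rewrite /= zF.
exists h => c; apply/esym; move: c;
  apply: (@hom_uniq (z1 \o act h) z2) => [a|c] /=.
  by rewrite act_fval zF.
by have := hE c.
Qed.

(* The lift to the coefficient algebra [S] of [Y] of the residue of a structure
   equals the structure, by uniqueness of lifts: no coefficient leaves [S]. *)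
Lemma structure_base g Yt : structure_over zeta Y g Yt ->
  exists z, (forall a, z (fval act a) = y a) /\
    forall a e, cval (coef (z a) e) = Yt a e.
Proof.
move=> st; have [tw lau YtY] := st;
  have [S1 [z1 [S1E z1E]]] := structure_hom st.
have YS1 a e : ca_set S1 (Y a e) by rewrite -YtY S1E; apply: coef_alg_gen.
have [|l1 l1P] := @local_commalg S1.
  by move=> X SX a e; apply: (ca_comm SX (YS1 a e)).
have sub : (ca_set S `<=` ca_set S1)%classic.
  rewrite SE => X; apply; split; first exact: ca_subalgebra.
  by move=> _ [a [e ->]].
have [f fE] := celt_inclusion sub.
have z1y a e : cval (coef (z1 (fval act a)) e) = cval (coef (y a) e).
  by rewrite z1E yE YtY.
have [||||z [zy zpi]] := @ext_lift _ _ _ _ act _ _ pi y (puiseux_map l1 \o z1).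
- exact: puiseux_reduced.
- by move=> b; apply: puiseux_map_residue_nilp lP.
- by move=> u; apply: puiseux_map_residue_sur lP.
- move=> a; apply: coef_inj => e.
  by have := celt_residue_eq l1P lP (z1y a e).
exists z; split=> // a e.
have : puiseux_map f (z a) = z1 a.
  move: a; apply: (@ext_uniq _ _ _ _ act _ (puiseux_map f \o z) z1) => [a|] /=.
    by rewrite zy; apply: coef_inj => d; apply: val_inj; rewrite /= z1y -fE.
  apply: (puiseux_map_residue_nilp l1P); rewrite rmorphB.
  have E : puiseux_map l1 (puiseux_map f (z (theta act)))
    = puiseux_map l1 (z1 (theta act)).
    rewrite -[RHS](zpi (theta act)); apply: coef_inj => d.
    by have := celt_residue_eq l1P lP (fE (coef (z (theta act)) d)).
  by apply/eqP; rewrite subr_eq0; apply/eqP; exact: esym E.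
by move=> E; rewrite -z1E -E coef_puiseux_map fE.
Qed.

(** Linearity over [C] is inherited from [Y], the constants being fixed by [G]. *)
Lemma hom_const z c : (forall a, z (fval act a) = y a) ->
  z c%:A = mono 0 (cconst S c).
Proof.
move=> zy; have -> : c%:A = fval act c%:A by rewrite [RHS]linearZ.
rewrite zy; apply: coef_inj => e; apply: val_inj; rewrite mono_coef.
rewrite -[LHS]/(cval (coef (y c%:A) e)) yE.
have lin0 : Y 0 e = 0.
  by have := tw_linear hY e (-1) 0 0; rewrite scaler0 addr0 scaleN1r addNr.
have := tw_linear hY e c 1 0; rewrite lin0 !addr0 => ->.
by rewrite (tw_vacuum hY); case: ifP => _ /=; rewrite ?scaler0.
Qed.

Lemma hom_linear z : (forall a, z (fval act a) = y a) ->
  forall e, linear (fun a => cval (coef (z a) e)).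
Proof.
move=> zy e c a b; rewrite rmorphD -mulr_algl rmorphM (hom_const _ zy) coefpD.
by rewrite coef_monoM subr0 /= -comp_lfunZl comp_lfun1l.
Qed.

(* [x d/dx (z c) - x z (D c)] is a derivation of [K] vanishing on [F]. *)
Lemma hom_der z : (forall a, z (fval act a) = y a) ->
  forall a e, cval (coef (z (D a)) e) = ratr (e + 1) *:
    cval (coef (z a) (e + 1)).
Proof.
move=> zy a e.
pose w (d : rat) := cconst S (ratr d).
have wD d d' : w (d + d') = w d + w d' by rewrite /w rmorphD rmorphD.
pose d c := hadamard w (z c) - mono 1 1 * z (D c).
have D0 : zmod_morphism D by move=> b c;
  rewrite -scaleN1r addrC (der_linear D) addrC scaleN1r.
have : d a = 0.
  apply: (@der_ext_eq0 _ _ _ _ act _ z d) => [b c|b c|b].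
  - by rewrite /d rmorphB hadamardB D0 rmorphB /=; ring.
  - rewrite /d rmorphM hadamard_der // derM rmorphD !rmorphM /=; ring.
  apply/eqP; rewrite subr_eq0; apply/eqP; apply: coef_inj => c; apply: val_inj.
  rewrite coef_monoM mul1r -[D _]/(fval act (fixed_der act b)) !zy.
  rewrite -[RHS]/(cval (coef (y (fixed_der act b)) (c - 1))) yE.
  rewrite (va_module_der hY (twisted_laurent hY))
    subrK /= -comp_lfunZl comp_lfun1l.
  by rewrite -yE.
move=> /eqP; rewrite subr_eq0 => /eqP /(congr1 (fun u =>
  cval (coef u (e + 1)))).
by rewrite coef_monoM mul1r addrK => <-; rewrite /= -comp_lfunZl comp_lfun1l.
Qed.

Lemma residue_embedding : exists phi : {rmorphism K -> puiseux C},
  forall a, phi (fval act a) = pi (y a).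
Proof.
have mm : minp act \is monic.
  by rewrite -(map_monic (fval act)) minpE monic_prod_XsubC.
have szm : (1 < size (minp act))%N.
  rewrite -(size_map_poly (fval act)) minpE size_prod_XsubC ltnS.
  rewrite /index_enum; case: index_enum_key; rewrite -enumT -cardT.
  by apply/card_gt0P; exists 1%g.
have [|| t /eqP rt] := @puiseux_root C (map_poly (pi \o y) (minp act)).
- by rewrite map_monic.
- by rewrite size_map_poly.
by have [phi [phiE _]] := exists_ext rt; exists phi.
Qed.

Lemma hom_laurent z p : (forall c, has_denom p (z c)) ->
  forall a, laurent p (opseries z a).
Proof.
move=> dz a; split; first by move=> e; apply: dz.
have [q [N [q0 gz]]] := coefP (z a); exists (- (N%:R / q%:R)) => e eN.
apply/eqP; apply: contraTT eN => /gz[k ->]; rewrite -leNgt mulrBl lerDr.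
by rewrite divr_ge0.
Qed.

(** Every element of [K] is a polynomial in [theta] over [F], whose image has integral exponents; a
    denominator of [z theta] therefore serves all of [K]. *)
Lemma hom_denom z : (forall a, z (fval act a) = y a) ->
  exists2 p, (0 < p)%N & forall c, has_denom p (z c).
Proof.
move=> zy; have [p p0 dp] := exists_denom (z (theta act)).
exists p; first exact: p0.
move=> c.
have dy a : has_denom 1 (y a).
  move=> e nz; apply: (tw_bilateral hY (a := a)); rewrite -yE.
  by apply: contraNneq nz => c0; apply/eqP/val_inj.
have [P <-] := gen_theta act c; rewrite (horner_ext P zy).
apply: denom_horner => // i; rewrite coef_map.
exact: denom_dvd (dvd1n p) (dy _).
Qed.

End BaseHom.

Lemma prim_root_exprz_eq1 p (n : int) : (0 < p)%N -> zeta p ^ n = 1 ->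
  n%:~R / p%:R \is a @Num.int rat.
Proof.
move=> p0; have pn0 : p%:R != 0 :> rat by rewrite pnatr_eq0 -lt0n.
have nat_case k : zeta p ^+ k = 1 -> k%:R / p%:R \is a @Num.int rat.
  move=> /eqP; rewrite -(prim_order_dvd (hzeta p0)) => /dvdnP[q ->].
  by rewrite natrM mulfK // natr_int.
case: n => k; first by rewrite -pmulrn => /nat_case.
rewrite NegzE -exprnN => /eqP; rewrite invr_eq1 => /eqP/nat_case.
by rewrite mulrNz mulNr rpredN -pmulrn.
Qed.

Lemma cconst_fix (S : commalg M) (c d : C) (x : celt S) : x != 0 ->
  cconst S c * x = cconst S d * x -> c = d.
Proof.
move=> x0 /(congr1 (@cval _ _ S)); rewrite /= -!comp_lfunZl !comp_lfun1l => e.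
apply/eqP; rewrite -subr_eq0; apply: contraNT x0 => cd; apply/eqP/val_inj.
apply/eqP; rewrite -[_ == _]orFb -(negPf cd) -scaler_eq0 scalerBl.
by rewrite [X in X - _]e subrr.
Qed.

(* [g] is given by the monodromy [x^e |-> zeta_p^(- e p) x^e], where [p] is the
   least common denominator of the exponents; minimality gives [#[g] = p]. *)
Lemma exists_structure : exists g Yt, structure_over zeta Y g Yt.
Proof.
have [S [y [SE yE]]] := base_hom.
have [|l lP] := @local_commalg S.
  move=> X SX a e; apply: (ca_comm SX).
  by rewrite SE; apply: coef_alg_gen.
have [phi phiE] := residue_embedding y l.
have [||||z [zy _]] := @ext_lift _ _ _ _ act _ _ (puiseux_map l) y phi => //.
- exact: puiseux_reduced.
- by move=> b; apply: puiseux_map_residue_nilp lP.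
- by move=> u; apply: puiseux_map_residue_sur lP.
have exp : exists p, `[< (0 < p)%N /\ forall c, has_denom p (z c) >].
  by have [p p0 dp] := hom_denom yE zy; exists p; apply/asboolP.
case: (ex_minnP exp) => p /asboolP[p0 dz] pmin.
(* On the exponents that occur [e p] is an integer and the floor merely converts it. The sign is the
   one that puts the modes [-e-1] of the eigenspace of [zeta_p^r] in [r/p + Z]. *)
pose ch (e : rat) : C := zeta p ^ (- Num.floor (e * p%:R)).
pose chi e := cconst S (ch e).
have wp : zeta p ^+ p = 1 := prim_expr_order (hzeta p0).
have w0 : zeta p != 0.
  by apply/eqP => w0; move/eqP: wp;
    rewrite w0 expr0n eqn0Ngt p0 eq_sym oner_eq0.
have chE e (t : int) : e * p%:R = t%:~R -> ch e = zeta p ^ (- t).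
  by move=> et; rewrite /ch et intrKfloor.
have chM d e : d * p%:R \is a Num.int -> e * p%:R \is a Num.int ->
  chi (d + e) = chi d * chi e.
  move=> /intrP[s ds] /intrP[t et];
    rewrite /chi -rmorphM (chE _ _ ds) (chE _ _ et).
  rewrite (chE _ (s + t)); first by rewrite opprD expfzDr.
  by rewrite mulrDl ds et rmorphD.
have ch_int (k : int) : ch k%:~R = 1.
  rewrite (chE _ (k * p%:Z)); last by rewrite rmorphM.
  by rewrite -mulNr mulrC -exprz_exp -exprnP wp exp1rz.
have chp e : ch e ^+ p = 1.
  by rewrite /ch exprnP exprzAC -exprnP wp exp1rz.
pose zs c := hadamard chi (z c).
have zsB : zmod_morphism zs by move=> a b; rewrite /zs rmorphB hadamardB.
have zsM : monoid_morphism zs.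
  split=> [|a b]; last by rewrite /zs rmorphM (hadamard_char chM).
  rewrite /zs rmorph1; apply: coef_inj => e;
    rewrite -[LHS]/(chi e * coef 1 e) coefp1.
  case: eqP => [->|_]; last by rewrite mulr0.
  by rewrite mulr1 /chi -[0]/(0%:~R) ch_int rmorph1.
pose zsBm := GRing.isZmodMorphism.Build _ _ zs zsB.
pose zsMm := GRing.isMonoidMorphism.Build _ _ zs zsM.
pose zsig : {rmorphism K -> puiseux (celt S)} := HB.pack zs zsBm zsMm.
(* The exponents of [y] are integers, where [ch] is 1: the monodromy preserves the restriction to
   [F]. *)
have zsF a : z (fval act a) = zsig (fval act a).
  apply: coef_inj => e; rewrite -[RHS]/(chi e * coef (z (fval act a)) e) zy.
  have [->|nz] := eqVneq (coef (y a) e) 0; first by rewrite mulr0.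
  have /intrP[k ->] : e \is a Num.int.
    rewrite -[e]mulr1; apply: (tw_bilateral hY (a := a)); rewrite -yE.
    by apply: contraNneq nz => c0; apply/eqP/val_inj.
  by rewrite /chi ch_int rmorph1 mul1r.
have [g gE] := hom_conj lP zsF.
have iter_g k c e : coef (z (act (g ^+ k)%g c)) e = chi e ^+ k * coef (z c) e.
  elim: k c => [|k IH] c; first by rewrite expg0 aut1 expr0 mul1r.
  rewrite expgSr autM IH exprSr -mulrA; congr (_ * _).
  by rewrite -[RHS]/(coef (zsig c) e) gE.
have gp : (g ^+ p)%g = 1%g.
  apply: act_inj => c; rewrite aut1; apply: (fmorph_inj z);
    apply: coef_inj => e.
  by rewrite iter_g /chi -rmorphXn chp rmorph1 mul1r.
(* As [g] to the power [#[g]] is 1, so is [ch e ^+ #[g]] for each exponent [e] that occurs; hence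
   [#[g]] is a common denominator and [p <= #[g]]. *)
have dg c : has_denom #[g]%g (z c).
  move=> e nz; have /intrP[t et] := dz c e nz.
  have : ch e ^+ #[g]%g = 1.
    apply: (cconst_fix nz); rewrite rmorph1 mul1r.
    by have := iter_g #[g]%g c e; rewrite expg_order aut1 /chi -rmorphXn.
  rewrite (chE _ _ et) exprnP exprz_exp => /(prim_root_exprz_eq1 p0).
  rewrite rmorphM rmorphN /= -et -pmulrn mulNr mulNr rpredN mulrAC mulfK //.
  by rewrite pnatr_eq0 -lt0n.
have ordg : #[g]%g = p.
  apply/eqP; rewrite eqn_leq dvdn_leq //=; last by rewrite order_dvdn gp.
  by apply: pmin; apply/asboolP; split=> //; apply: order_gt0.
have lin := hom_linear yE zy.
exists g; exists (opseries z); split.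
- rewrite ordg; apply: hom_twisted_module => //.
  + by move=> a e; have := hom_der yE zy a e.
  + exact: hom_laurent.
  move=> r u rp eu i nz.
  have nz' : coef (z u) (- i - 1) != 0.
    by apply: contraNneq nz => c0; rewrite /mode /opseries c0.
  have /intrP[t et] := dz u _ nz'.
  have : ch (- i - 1) = zeta p ^+ r.
    apply: (cconst_fix nz').
    rewrite -[LHS]/(coef (zsig u) (- i - 1)) gE /= eu -mulr_algl rmorphM.
    by rewrite (hom_const yE _ zy) coef_monoM subr0.
  rewrite (chE _ _ et) => E.
  have /(prim_root_exprz_eq1 p0) : zeta p ^ (t + r%:Z) = 1.
    by rewrite expfzDr // -exprnP -E -expfzDr // subrr.
  rewrite rmorphD /= -et -pmulrn mulrDl mulfK; last by rewrite pnatr_eq0 -lt0n.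
  move=> h; rewrite /in_coset.
  have -> : i - r%:R / p%:R = - (- i - 1 + r%:R / p%:R) - 1 by ring.
  by rewrite rpredB ?rpredN ?rpred1.
- by rewrite ordg; apply: hom_laurent.
by move=> a e; rewrite -yE -zy.
Qed.

Theorem structures :
  [/\ exists (g : G) (Yt : K -> rat -> 'End(M)), structure_over zeta Y g Yt,
      forall (g : G) (Y1 Y2 : K -> rat -> 'End(M)),
        structure_over zeta Y g Y1 -> structure_over zeta Y g Y2 ->
        psi Y1 =2 psi Y2 -> module_iso Y1 Y2,
      forall (g : G) (Yt : K -> rat -> 'End(M)),
        structure_over zeta Y g Yt ->
        (forall h : G, laurent_hom #[g]%g (twist act Yt h)) /\
        (forall h1 h2 : G, twist act Yt h1 =2 twist act Yt h2 -> h1 = h2) &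
      forall (g1 g2 : G) (Y1 Y2 : K -> rat -> 'End(M)),
        structure_over zeta Y g1 Y1 -> structure_over zeta Y g2 Y2 ->
        exists h : G, module_iso (twist act Y1 h) Y2].
Proof.
have [S [y [SE yE]]] := base_hom.
have [|l lP] := @local_commalg S.
  move=> X SX a e; apply: (ca_comm SX).
  by rewrite SE; apply: coef_alg_gen.
have iso_eq (Y1 Y2 : K -> rat -> 'End(M)) : Y1 =2 Y2 -> module_iso Y1 Y2.
  move=> Y12; exists \1%VF; split.
    by exists id => v; rewrite id_lfunE.
  by move=> a e; rewrite comp_lfun1l comp_lfun1r Y12.
have base := structure_base SE yE lP.
(* The modes of a structure lie in [S] and include those of [Y], so its coefficient algebra is [S],
   and [psi] is the residue [l]. *)
have psiE g Yt z : structure_over zeta Y g Yt ->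
    (forall a e, cval (coef (z a) e) = Yt a e) ->
    forall a e, psi Yt a e = [:: l (coef (z a : puiseux (celt S)) e)].
  move=> [_ _ YtY] zE a e; rewrite -(semisimple_part_local lP) zE /psi.
  suff -> : coef_alg Yt = ca_set S by [].
  apply/seteqP; split.
    apply: (_ : forall X, _) => X; apply; split; first exact: ca_subalgebra.
    by move=> _ [b [d ->]]; rewrite -zE; apply: celtP.
  rewrite SE => X; apply; split; first exact: coef_alg_subalgebra.
  by move=> _ [b [d ->]]; rewrite -YtY; apply: coef_alg_gen.
split.
- exact: exists_structure.
- move=> g Y1 Y2 st1 st2 psi12; apply: iso_eq.
  have [z1 [z1y z1E]] := base _ _ st1; have [z2 [z2y z2E]] := base _ _ st2.
  have z12 : z1 =1 z2.
    apply: (hom_uniq lP) => [a|c]; first by rewrite z1y z2y.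
    apply: coef_inj => e; have := psi12 c e.
    by rewrite (psiE _ _ _ st1 z1E) (psiE _ _ _ st2 z2E) => -[].
  by move=> a e; rewrite -z1E -z2E z12.
- move=> g Yt st; have [z [zy zE]] := base _ _ st; have [tw lau _] := st; split.
    move=> h; split.
    + by move=> a; apply: lau.
    + by move=> e c a b; rewrite /twist linearP (tw_linear tw).
    + by move=> e; rewrite /twist rmorph1 (tw_vacuum tw).
    move=> a b e; rewrite /twist rmorphM -zE rmorphM cval_coefM.
    by apply: eq_fsbigr => d _; rewrite !zE.
  (* [z] is injective, its source being a field, so equal twists come from equal automorphisms. *)
  move=> h1 h2 h12; apply: act_inj => a; apply: (fmorph_inj z).
  by apply: coef_inj => e; apply: val_inj; rewrite [LHS]zE [RHS]zE; apply: h12.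
move=> g1 g2 Y1 Y2 st1 st2.
have [z1 [z1y z1E]] := base _ _ st1; have [z2 [z2y z2E]] := base _ _ st2.
have [|h hE] := hom_conj lP (z1 := z1) (z2 := z2); first by move=> a;
  rewrite z1y z2y.
exists h; apply: iso_eq => a e; rewrite /twist -z1E -z2E.
by have := hE a => /= ->.
Qed.

End Structures.

Theorem theorem1 (R : realType) (zeta : nat -> R[i])
    (hzeta : forall p, (0 < p)%N -> p.-primitive_root (zeta p))
    (K : fieldAlgType R[i]) (D : derivation K)
    (G : finGroupType) (act : autGroup D G)
    (M : vectType R[i]) (Y : fixed act -> rat -> 'End(M))
    (hY : va_module (fixed_der act) zeta Y)
    (hM : (fullv : {vspace M}) != 0%VS)
    (hind : indecomposable Y) :
  [/\ exists (g : G) (Yt : K -> rat -> 'End(M)), structure_over zeta Y g Yt,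
      forall (g : G) (Y1 Y2 : K -> rat -> 'End(M)),
        structure_over zeta Y g Y1 -> structure_over zeta Y g Y2 ->
        psi Y1 =2 psi Y2 -> module_iso Y1 Y2,
      forall (g : G) (Yt : K -> rat -> 'End(M)),
        structure_over zeta Y g Yt ->
        (forall h : G, laurent_hom #[g]%g (twist act Yt h)) /\
        (forall h1 h2 : G, twist act Yt h1 =2 twist act Yt h2 -> h1 = h2) &
      forall (g1 g2 : G) (Y1 Y2 : K -> rat -> 'End(M)),
        structure_over zeta Y g1 Y1 -> structure_over zeta Y g2 Y2 ->
        exists h : G, module_iso (twist act Y1 h) Y2].
Proof.
exact: structures.
Qed.
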